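(* Assume the setting described in the context, assume for all $x\in[a,b]^{\ell_0}$ that $f(x)=f(0)$, and let $\Theta\in C([0,\infty),\mathbb R^{\mathfrak d})$ satisfy for all $t\in[0,\infty)$ that $\Theta_t=\Theta_0-\int_0^t\mathcal G(\Theta_s)\,ds$. Then (i) $\sup_{t\in[0,\infty)}\|\Theta_t\|\le[2V(\Theta_0)+4L^2\|f(0)\|^2]^{1/2}<\infty$, (ii) for all $t\in(0,\infty)$ it holds that $\mathcal L_\infty(\Theta_t)\le\frac1{2t}[\|\Theta_0\|^2+2L\|f(0)\|^2]<\infty$, and (iii) $\limsup_{t\to\infty}\mathcal L_\infty(\Theta_t)=0$.
   Context: Setting. Let $L,\mathfrak d\in\mathbb N=\{1,2,\dots\}$, $(\ell_k)_{k\in\mathbb N_0}\subseteq\mathbb N$, $a\in\mathbb R$, $b\in(a,\infty)$, $\mathscr A\in(0,\infty)$, $\mathscr B\in(\mathscr A,\infty)$ with $\mathfrak d=\sum_{k=1}^L\ell_k(\ell_{k-1}+1)$; let $\mathbf d_k=\sum_{h=1}^k\ell_h(\ell_{h-1}+1)$ for $k\in\mathbb N_0$. For $\theta=(\theta_1,\dots,\theta_{\mathfrak d})\in\mathbb R^{\mathfrak d}$, $k\in\{1,\dots,L\}$, $i\in\{1,\dots,\ell_k\}$, $j\in\{1,\dots,\ell_{k-1}\}$ let $\mathfrak w^{k,\theta}_{i,j}=\theta_{(i-1)\ell_{k-1}+j+\mathbf d_{k-1}}$ and $\mathfrak b^{k,\theta}_i=\theta_{\ell_k\ell_{k-1}+i+\mathbf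 d_{k-1}}$, let $\mathfrak w^{k,\theta}=(\mathfrak w^{k,\theta}_{i,j})_{i,j}\in\mathbb R^{\ell_k\times\ell_{k-1}}$, $\mathfrak b^{k,\theta}=(\mathfrak b^{k,\theta}_1,\dots,\mathfrak b^{k,\theta}_{\ell_k})\in\mathbb R^{\ell_k}$, and $\mathcal A^\theta_k\colon\mathbb R^{\ell_{k-1}}\to\mathbb R^{\ell_k}$, $\mathcal A^\theta_k(x)=\mathfrak b^{k,\theta}+\mathfrak w^{k,\theta}x$. Let $\mathscr R_\infty(x)=\max\{x,0\}$ and let $\mathscr R_r\colon\mathbb R\to\mathbb R$, $r\in[1,\infty)$, satisfy for all $r\in[1,\infty)$: $\mathscr R_r\in C^1(\mathbb R,\mathbb R)$, $\mathscr R_r(x)=0$ for all $x\le\mathscr A r^{-1}$, $0\le\mathscr R_r(y)\le\max\{y,0\}$ for all $y\in\mathbb R$, $\mathscr R_r(z)=z$ for all $z\ge\mathscr B r^{-1}$; assume $\sup_{r\in[1,\infty)}\sup_{x\in\mathbb R}|(\mathscr R_r)'(x)|<\infty$. $\|\cdot\|$, $\langle\cdot,\cdot\rangle$ are the Euclidean norm and scalar product on each $\mathbb R^n$; for $r\in[1,\infty]$, $\mathfrak M_r(x_1,\dots,x_n)=(\mathscr R_r(x_1),\dots,\mathscr R_r(x_n))$. For $r\in[1,\infty]$, $\theta\in\mathbb R^{\mathfrak d}$ define $\mathcal N^{k,\theta}_r\colon\mathbb R^{\ell_0}\to\mathbb R^{\ell_k}$, $k\in\{1,\dots,L\}$, by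 $\mathcal N^{1,\theta}_r=\mathcal A^\theta_1$ and $\mathcal N^{k+1,\theta}_r(x)=\mathcal A^\theta_{k+1}(\mathfrak M_{r^{1/k}}(\mathcal N^{k,\theta}_r(x)))$ (with $\infty^{1/k}=\infty$). Let $\mu$ be a measure on the Borel $\sigma$-algebra of $[a,b]^{\ell_0}$ with $\mu([a,b]^{\ell_0})\in\mathbb R$, let $f=(f_1,\dots,f_{\ell_L})\colon\mathbb R^{\ell_0}\to\mathbb R^{\ell_L}$ be measurable (only its values on $[a,b]^{\ell_0}$ and the value $f(0)$ enter), and for $r\in[1,\infty]$ let $\mathcal L_r\colon\mathbb R^{\mathfrak d}\to\mathbb R$ be given by $\mathcal L_r(\theta)=\int_{[a,b]^{\ell_0}}\|\mathcal N^{L,\theta}_r(x)-f(x)\|^2\,\mu(dx)$ (these integrals are real numbers as part of the setting). Let $\mathcal G\colon\mathbb R^{\mathfrak d}\to\mathbb R^{\mathfrak d}$ satisfy $\mathcal G(\theta)=\lim_{r\to\infty}(\nabla\mathcal L_r)(\theta)$ for every $\theta$ for which $((\nabla\mathcal L_r)(\theta))_{r\in[1,\infty)}$ is convergent as $r\to\infty$. Let $V\colon\mathbb R^{\mathfrak d}\to\mathbb R$, $V(\theta)=\big[\sum_{k=1}^L\big(k\|\mathfrak b^{k,\theta}\|^2+\sum_{i=1}^{\ell_k}\sum_{j=1}^{\ell_{k-1}}|\mathfrak w^{k,\theta}_{i,j}|^2\big)\big]-2L\langle f(0),\mathfrak b^{L,\theta}\rangle$. *)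

(* Defs.v *)
From HB Require Import structures.
From mathcomp Require Import all_boot all_order all_algebra.
From mathcomp Require Import all_classical all_reals all_analysis.
Unset Printing Implicit Defensive.
Import Order.TTheory GRing.Theory Num.Theory.
Import numFieldNormedType.Exports.
Local Open Scope classical_set_scope.
Local Open Scope ring_scope.

Section Defs.
Variable R : realType.

(* Euclidean norm and scalar product on R^n = 'rV[R]_n
   (the library norm on 'rV is the max norm, hence this definition) *)
Definition enorm n (v : 'rV[R]_n) : R := Num.sqrt (\sum_(i < n) v ord0 i ^+ 2).
Definition edot n (u v : 'rV[R]_n) : R := \sum_(i < n) u ord0 i * v ord0 i.

Definition borelRn n := g_sigma_algebraType (@open ('rV[R]_n)).

Definition cube n (a b : R) : set 'rV[R]_n := [set x | forall i, a <= x ord0 i <= b].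

(* 0-based access theta_(m+1) to the coordinates of theta (0 outside range) *)
Definition coord d (th : 'rV[R]_d) (m : nat) : R :=
  match (insub m : option 'I_d) with Some i => th ord0 i | None => 0 end.

Definition dd (l : nat -> nat) (k : nat) : nat :=
  (\sum_(1 <= h < k.+1) l h * (l h.-1 + 1))%N.

(* weights and biases, with 0-based i, j (w^{k}_{i+1,j+1}, b^{k}_{i+1}) *)
Definition wgt (l : nat -> nat) d (th : 'rV[R]_d) (k i j : nat) : R :=
  coord d th (i * l k.-1 + j + dd l k.-1)%N.
Definition bia (l : nat -> nat) d (th : 'rV[R]_d) (k i : nat) : R :=
  coord d th (l k * l k.-1 + i + dd l k.-1)%N.

(* Realization: net l th sig x k i = i-th (0-based) component of N^{k,th}(x),
   where sig k is the activation applied to the output of layer k. *)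
Fixpoint net (l : nat -> nat) d (th : 'rV[R]_d) (sig : nat -> R -> R)
  (x : 'rV[R]_(l 0%N)) (k i : nat) {struct k} : R :=
  match k with
  | 0%N => 0
  | k'.+1 =>
    match k' with
    | 0%N => bia l d th 1 i + \sum_(j < l 0%N) wgt l d th 1 i j * x ord0 j
    | _.+1 => bia l d th k i +
        \sum_(j < l k') wgt l d th k i j * sig k' (net l d th sig x k' j)
    end
  end.

Definition sig_fin (Rr : R -> R -> R) (r : R) : nat -> R -> R :=
  fun k y => Rr (r `^ (k%:R)^-1) y.
Definition sig_inf : nat -> R -> R := fun _ y => Num.max y 0.

Definition loss (l : nat -> nat) (L : nat) d (a b : R)
  (mu : {measure set (borelRn (l 0%N)) -> \bar R})
  (f : 'rV[R]_(l 0%N) -> 'rV[R]_(l L)) (sig : nat -> R -> R)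
  (th : 'rV[R]_d) : R :=
  fine (\int[mu]_(x in cube (l 0%N) a b)
          (\sum_(i < l L) (net l d th sig x L i - f x ord0 i) ^+ 2)%:E).

Definition grad d (F : 'rV[R]_d -> R) (th : 'rV[R]_d) : 'rV[R]_d :=
  \row_(i < d) ('D_(delta_mx 0 i) F th).

Definition Vfun (l : nat -> nat) (L : nat) d (f0 : 'rV[R]_(l L))
  (th : 'rV[R]_d) : R :=
  \sum_(1 <= k < L.+1) (k%:R * \sum_(i < l k) bia l d th k i ^+ 2
      + \sum_(i < l k) \sum_(j < l k.-1) wgt l d th k i j ^+ 2)
  - 2 * L%:R * \sum_(i < l L) f0 ord0 i * bia l d th L i.

End Defs.

Arguments enorm {R n} v.
Arguments edot {R n} u v.

(* Main.v *)
(** The gradients of the smoothed risks converge everywhere, because the error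
    of layer k caused by the smoothing of the layers below it is o(r^(-1/k)),
    whereas the activation of layer k is modified only on an interval of width
    of order r^(-1/k); so G is the formal gradient of the ReLU risk in which
    the derivative of ReLU at 0 is taken to be 0.  Passing to the limit in the
    chain rule for the smoothed risks along Theta shows that the risk decreases
    at the rate |G(Theta)|^2.  By Euler's identity for the layerwise
    homogeneous network, the inner product of the gradient of V with G is 4 L
    times the risk when the target is constant; hence V decreases along Theta,
    and 4 L t risk(Theta_t) <= V(Theta_0) - V(Theta_t) by monotonicity of the
    risk.  Completing squares bounds V from above and below. *)
Require Import Defs.
From HB Require Import structures.
From mathcomp Require Import all_boot all_order all_algebra.
From mathcomp Require Import all_classical all_reals all_analysis.
From mathcomp Require Import measurable_realfun ring lra.
Import Order.TTheory GRing.Theory Num.Theory.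
Import numFieldNormedType.Exports.
Local Open Scope classical_set_scope.
Local Open Scope ring_scope.

(** * Dominated convergence along countably based filters *)

(** Neither the ReLU risk nor the curve need be differentiable: the integral equation makes the
    curve the integral of a function that is only measurable and locally bounded. The chain rule is
    therefore proved for functions with continuous gradient, from the integral equation alone, and
    reaches the ReLU risk only as a limit; this forces all bounds on networks and gradients to be
    uniform in the smoothing parameter. The coefficients of V come from a scaling: multiplying all
    weights by lambda and the biases of layer k by lambda^k multiplies the output of layer k by
    lambda^k. The gradient of V is twice the generator of this scaling, and the linear term of V
    shifts it so that the output N of the last layer is replaced by N - f(0). The activation s
    enters only through s'(y) y = s(y), which ReLU satisfies with the value 0 at the kink. *)

Definition countably_based {U : Type} (F : set_system U) (B : nat -> set U) :=
  (forall n, F (B n)) /\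
  (forall A, F A -> exists n, forall m, (n <= m)%N -> B m `<=` A).

Section dominated.
Context d (T : measurableType d) (R : realType) (mu : {measure set T -> \bar R}).
Variables (D : set T) (mD : measurable D) (muD : (mu D < +oo)%E).

Lemma bounded_Rintegrable (f : T -> R) (C : R) :
  measurable_fun D f -> (forall x, D x -> `|f x| <= C) ->
  mu.-integrable D (EFin \o f).
Proof.
move=> mf fC; apply: measurable_bounded_integrable => //.
exists C; split; first exact: num_real.
by move=> M CM x Dx; rewrite /= (le_trans (fC _ Dx)) // ltW.
Qed.

Lemma Rintegral_cvg_seq (f : nat -> T -> R) (g : T -> R) (C : R) :
  (forall n, measurable_fun D (f n)) ->
  (forall n x, D x -> `|f n x| <= C) ->
  (forall x, D x -> f n x @[n --> \oo] --> g x) ->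
  \int[mu]_(x in D) f n x @[n --> \oo] --> \int[mu]_(x in D) g x.
Proof.
move=> mf fC fg.
have mg : measurable_fun D g by exact: (measurable_fun_cvg mf).
have [] := @dominated_convergence _ T R mu D mD (fun n => EFin \o f n)
  (EFin \o g) (EFin \o cst C).
- by move=> n; exact/measurable_EFinP.
- exact/measurable_EFinP.
- by apply: aeW => x Dx; apply: cvg_EFin; [exact: nearW|exact: fg].
- by apply: (bounded_Rintegrable _ `|C|).
- by apply: aeW => x n Dx; rewrite lee_fin; exact: fC.
- move=> ig _ h; apply: fine_cvg; rewrite fineK; first exact: h.
  exact: integrable_fin_num.
Qed.

(** Dominated convergence concerns sequences. If the integrals failed to converge along [F], every
    [B n] would contain a bad index [u n]; these form a sequence tending to [F], along which the
    integrals do converge. *)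
Lemma Rintegral_cvg {U : Type} {F : set_system U} {FF : Filter F}
    (B : nat -> set U) (f : U -> T -> R) (g : T -> R) (C : R) :
  countably_based F B ->
  (\forall u \near F, measurable_fun D (f u)) ->
  (\forall u \near F, forall x, D x -> `|f u x| <= C) ->
  (forall x, D x -> f u x @[u --> F] --> g x) ->
  \int[mu]_(x in D) f u x @[u --> F] --> \int[mu]_(x in D) g x.
Proof.
move=> [FB BF] mf fC fg; apply/cvgrPdist_lt => e e0; apply: contrapT => nF.
have /choice[u uP] : forall n, exists u, [/\ B n u, measurable_fun D (f u),
    forall x, D x -> `|f u x| <= C &
    ~ `|\int[mu]_(x in D) g x - \int[mu]_(x in D) f u x| < e].
  move=> n; apply: contrapT => nu; apply: nF.
  near=> u; apply: contrapT => eu; apply: nu; exists u; split => //.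
  - by near: u.
  - by near: u.
  - by near: u.
have uF : u n @[n --> \oo] --> F.
  by move=> A /BF[n nA]; exists n => // m /= /nA; apply; case: (uP m).
have : \int[mu]_(x in D) f (u n) x @[n --> \oo] --> \int[mu]_(x in D) g x.
  apply: (Rintegral_cvg_seq (fun n => f (u n)) g C).
  - by move=> n; case: (uP n).
  - by move=> n; case: (uP n).
  - by move=> x Dx; exact: (cvg_comp _ _ uF (fg x Dx)).
move/cvgrPdist_lt => /(_ _ e0)[n _ /(_ n (leqnn n))].
by case: (uP n).
Unshelve. all: by end_near. Qed.

End dominated.

Lemma countably_based_nbhs (R : realType) (V : pseudoMetricType R) (a : V) :
  countably_based (nbhs a) (fun n => ball a n.+1%:R^-1).
Proof.
split=> [n|A /nbhs_ballP[e /= e0 eA]].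
  by apply: nbhsx_ballx; rewrite invr_gt0.
exists (Num.trunc e^-1) => m em x ax; apply: eA.
apply: le_ball ax.
rewrite invf_ple ?posrE// (le_trans (ltW (truncnS_gt _)))// ler_nat ltnS//.
Qed.

Lemma countably_based_pinfty (R : realType) :
  countably_based (pinfty_nbhs R) (fun n => [set x | n%:R < x]).
Proof.
split=> [n|A [M [Mr MA]]]; first by exists n%:R; split.
exists (Num.trunc M).+1 => m Mm x /= mx; apply: MA.
rewrite (lt_trans _ mx)// (lt_le_trans (truncnS_gt _))// ler_nat//.
Qed.

Section integral_sums.
Context d (T : measurableType d) (R : realType) (mu : {measure set T -> \bar R}).
Variables (D : set T) (mD : measurable D).

Lemma integrable_lincomb n (c : 'I_n -> R) (f : 'I_n -> T -> R) :
  (forall i, mu.-integrable D (EFin \o f i)) ->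
  mu.-integrable D (EFin \o (fun x => \sum_(i < n) c i * f i x)).
Proof.
move=> fi.
have -> : EFin \o (fun x => \sum_(i < n) c i * f i x) =
    (fun x => \sum_(i < n) (c i)%:E * (EFin \o f i) x)%E.
  by apply/funext => x /=; rewrite -sumEFin; apply: eq_bigr => i _; rewrite EFinM.
by apply: integrable_sum => // i _; exact: integrableZl.
Qed.

Lemma Rintegral_lincomb n (c : 'I_n -> R) (f : 'I_n -> T -> R) :
  (forall i, mu.-integrable D (EFin \o f i)) ->
  \int[mu]_(x in D) (\sum_(i < n) c i * f i x) =
  \sum_(i < n) c i * \int[mu]_(x in D) f i x.
Proof.
elim: n c f => [|n IH] c f fi.
  rewrite big_ord0; under eq_Rintegral do rewrite big_ord0.
  by rewrite Rintegral_cst// mul0r.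
under eq_Rintegral do rewrite big_ord_recl.
rewrite RintegralD//.
- by rewrite RintegralZl// IH// big_ord_recl.
- have := integrable_lincomb 1 (fun=> c ord0) (fun=> f ord0) (fun=> fi ord0).
  by under [X in _ \o X]eq_fun do rewrite big_ord1; apply.
- apply: (integrable_lincomb n (c \o lift ord0) (f \o lift ord0)) => i.
  exact: fi.
Qed.

End integral_sums.

(** * The chain rule along an integral curve *)

(** The estimate says that the derivative vanishes, so the mean value theorem applies. It is
    required at every point, which leaves no exceptional null set to deal with. *)
Lemma locally_flat_cst (R : realType) (T : R) (H : R -> R) : 0 <= T ->
  (forall x e : R, 0 <= x <= T -> 0 < e -> exists2 r : R, 0 < r &
     forall y : R, 0 <= y <= T -> `|y - x| < r -> `|H y - H x| <= e * `|y - x|) ->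
  H T = H 0.
Proof.
move=> T0 flat.
have [x||c _ /eqP] := @MVT_segment R H (cst 0) 0 T T0;
  last by rewrite mul0r subr_eq0 => /eqP.
2: {
  apply/subspace_continuousP => x; rewrite /= in_itv/= => xT.
  have [r r0 rP] := flat x 1 xT ltr01.
  apply/cvgrPdist_lt => e e0; rewrite near_withinE; near=> y.
  rewrite /= in_itv/= => yT; rewrite distrC.
  have yx : `|y - x| < Num.min r e.
    rewrite distrC; near: y; apply: cvgr_dist_lt => //.
    by rewrite lt_min r0.
  move: yx; rewrite lt_min => /andP[yr ye].
  by rewrite (le_lt_trans (rP y yT yr))// mul1r. }
- rewrite in_itv/= => /andP[x0 xT].
  have cv : h^-1 *: (H (h *: 1 + x) - H x) @[h --> 0^'] --> (0 : R).
    apply/cvgrPdist_le => e e0.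
    have [||r r0 rP] := flat x e => //; first by rewrite !ltW.
    near=> h; rewrite sub0r normrN normrZ normfV.
    have h0 : h != 0 by near: h; exact: nbhs_dnbhs_neq.
    have hm : `|h| < Num.min r (Num.min x (T - x)).
      near: h; apply: dnbhs0_lt.
      by rewrite !lt_min r0 x0 subr_gt0.
    move: hm; rewrite !lt_min => /and3P[hr hx hT].
    rewrite mulrC ler_pdivrMr ?normr_gt0//.
    have := rP (h *: 1 + x); rewrite addrK /GRing.scale/= mulr1; apply => //.
    move: hx hT; rewrite !ltr_norml => /andP[? ?] /andP[? ?].
    by apply/andP; split; lra.
  split; first by apply/cvg_ex; exists 0.
  by apply/cvg_lim.
Unshelve. all: by end_near. Qed.

Lemma within_continuous_postcomp {T U W : topologicalType} (A : set T)
    (f : T -> U) (h : U -> W) :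
  {within A, continuous f} -> continuous h -> {within A, continuous (h \o f)}.
Proof.
move=> /subspace_continuousP cf ch; apply/subspace_continuousP => x Ax.
exact: cvg_comp (cf x Ax) (ch _).
Qed.

Lemma lebesgue_itv_fin (R : realType) (s t : R) :
  (@lebesgue_measure R `[s, t]%classic < +oo)%E.
Proof. by rewrite lebesgue_measure_itv/=; case: ifP; rewrite ?ltry// -EFinB ltry. Qed.

Lemma Rintegral_itv0B (R : realType) (f : R -> R) (s t : R) : 0 <= s <= t ->
  (@lebesgue_measure R).-integrable `[0, t] (EFin \o f) ->
  \int[lebesgue_measure]_(u in `]s, t]) f u =
  \int[lebesgue_measure]_(u in `[0, t]) f u -
  \int[lebesgue_measure]_(u in `[0, s]) f u.
Proof.
by move=> /andP[s0 st] fi; rewrite (@Rintegral_itvB _ _ (BLeft 0) (BRight t) s) ?bnd_simp.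
Qed.

Section gradient_chain_rule.
Context (R : realType) (d : nat).
Local Notation V := 'rV[R]_d.

(** Differentiability along every line, at every point of it: the form in which the one-dimensional
    mean value theorem applies. With continuity of [DF], it is all that the chain rule needs to know
    about [F]. *)
Definition has_gradient (F : V -> R) (DF : V -> V) :=
  forall th v h, is_derive (h : R) (1 : R) (fun k => F (th + k *: v))
    (edot (DF (th + h *: v)) v).

Lemma coord_le_norm (v : V) i : `|v ord0 i| <= `|v|.
Proof.
rewrite [`|v|]mx_normrE.
exact: (le_bigmax _ (fun ij => `|v ij.1 ij.2|) (ord0, i)).
Qed.

Lemma mean_value_line (F : V -> R) (DF : V -> V) (u v : V) :
  has_gradient F DF ->
  exists2 c, 0 <= c <= 1 & F v - F u = edot (DF (u + c *: (v - u))) (v - u).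
Proof.
move=> FD.
have [h _||c] := @MVT_segment R (fun k => F (u + k *: (v - u)))
  (fun h => edot (DF (u + h *: (v - u))) (v - u)) 0 1 ler01.
- exact: FD.
- apply: derivable_within_continuous => h _.
  by have [] := FD u (v - u) h.
- rewrite in_itv/= => c01; rewrite scale0r addr0 scale1r (addrC u) subrK subr0 mulr1.
  by exists c.
Qed.

Variables (F : V -> R) (DF : V -> V) (Theta g : R -> V) (T M : R).
Hypotheses (T0 : 0 <= T) (FD : has_gradient F DF) (cDF : continuous DF).
Hypothesis cTheta : {within `[0, T], continuous Theta}.
Hypothesis mg : forall i, measurable_fun `[0, T] (fun s => g s ord0 i).
Hypothesis gM : forall (s : R) i, 0 <= s <= T -> `|g s ord0 i| <= M.
Hypothesis Thetag : forall (t : R) i, 0 <= t <= T ->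
  Theta t ord0 i =
  Theta 0 ord0 i - \int[lebesgue_measure]_(s in `[0, t]) g s ord0 i.

Local Notation mu := (@lebesgue_measure R).

Let cDFT : {within `[0, T], continuous (DF \o Theta)}.
Proof. exact: within_continuous_postcomp. Qed.

Lemma gradient_curve_bounded :
  exists C : R, forall s : R, 0 <= s <= T -> `|DF (Theta s)| <= C.
Proof.
have := continuous_compact cDFT (@segment_compact R 0 T).
move=> /compact_bounded[C [_ CP]]; exists (C + 1) => s sT.
by apply: (CP (C + 1)); [lra|exists s].
Qed.

Lemma measurable_gradient_curve i :
  measurable_fun `[0, T] (fun s => DF (Theta s) ord0 i).
Proof.
apply: subspace_continuous_measurable_fun; first exact: measurable_itv.
apply: (within_continuous_postcomp _ (DF \o Theta) (fun v : V => v ord0 i)).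
  exact: cDFT.
exact: coord_continuous.
Qed.

Let w s := edot (DF (Theta s)) (g s).

Lemma edot_bound (u v : V) (a b : R) : (forall i, `|u ord0 i| <= a) ->
  (forall i, `|v ord0 i| <= b) -> `|edot u v| <= a * b *+ d.
Proof.
move=> ua vb; rewrite /edot (le_trans (ler_norm_sum _ _ _))//.
rewrite -[d in leRHS]card_ord -sumr_const; apply: ler_sum => i _.
by rewrite normrM ler_pM.
Qed.

Lemma measurable_edot_curve (u : R -> V) :
  (forall i, measurable_fun `[0, T] (fun s => u s ord0 i)) ->
  measurable_fun `[0, T] (fun s => edot (u s) (g s)).
Proof.
by move=> mu_; apply: measurable_sum => i; exact: measurable_funM.
Qed.

Lemma integrable_gradient_curve : mu.-integrable `[0, T] (EFin \o w).
Proof.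
have [C CP] := gradient_curve_bounded.
apply: (@bounded_Rintegrable _ _ _ mu _ _ _ _ (`|C| * M *+ d)) => //.
- exact: lebesgue_itv_fin.
- by apply: measurable_edot_curve; exact: measurable_gradient_curve.
- move=> x; rewrite /= in_itv/= => xT; apply: edot_bound => i; last exact: gM.
  by rewrite (le_trans (coord_le_norm _ _))// (le_trans (CP _ xT))// ler_norm.
Qed.

Let iw (s t : R) : 0 <= s -> t <= T ->
  mu.-integrable `]s, t] (EFin \o w) /\ mu.-integrable `[0, t] (EFin \o w).
Proof.
move=> s0 tT; have iT := integrable_gradient_curve.
split; apply: integrableS iT => //; apply: subset_itv; rewrite bnd_simp//.
Qed.

Let ig (s t : R) i : 0 <= s -> t <= T ->
  mu.-integrable `]s, t] (EFin \o (fun x => g x ord0 i)) /\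
  mu.-integrable `[0, t] (EFin \o (fun x => g x ord0 i)).
Proof.
move=> s0 tT.
have iT : mu.-integrable `[0, T] (EFin \o (fun x => g x ord0 i)).
  apply: (@bounded_Rintegrable _ _ _ mu _ _ _ _ M) => //.
  - exact: lebesgue_itv_fin.
  - exact: mg.
  - by move=> x; rewrite /= in_itv/= => xT; exact: gM.
split; apply: integrableS iT => //; apply: subset_itv; rewrite bnd_simp//.
Qed.

Let H t := F (Theta t) + \int[mu]_(s in `[0, t]) w s.

(** By the integral equation, the mean value formula turns [F (Theta s) - F (Theta t)] into the
    integral of [edot (DF xi) (g u)] over []s, t]], for a single point [xi] of the chord. What
    remains is the variation of [DF] between chord and curve, and [g] enters the estimate only
    through its bound [M]. *)
Let H_increment (s t e : R) : 0 <= s <= t -> t <= T -> 0 <= e ->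
  (forall c u : R, 0 <= c <= 1 -> s <= u <= t ->
    `|DF (Theta u) - DF (Theta s + c *: (Theta t - Theta s))| <= e) ->
  `|H t - H s| <= e * M *+ d * (t - s).
Proof.
move=> /andP[s0 st] tT e0 De.
have [iw1 iw2] := iw s t s0 tT.
have [c c01 Fc] := mean_value_line F DF (Theta s) (Theta t) FD.
set xi := Theta s + _ in Fc.
have mst : measurable (`]s, t] : set R) by exact: measurable_itv.
have ix : mu.-integrable `]s, t] (EFin \o (fun u => edot (DF xi) (g u))).
  apply: (integrable_lincomb _ _ _ mu _ mst _ (fun i => DF xi ord0 i)
    (fun i u => g u ord0 i)) => // i.
  by have [] := ig s t i s0 tT.
have -> : H t - H s = \int[mu]_(u in `]s, t]) (w u - edot (DF xi) (g u)).
  rewrite RintegralB// Rintegral_itv0B ?s0//.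
  have -> : \int[mu]_(u in `]s, t]) edot (DF xi) (g u) = F (Theta s) - F (Theta t).
    rewrite (Rintegral_lincomb _ _ _ mu _ mst _ (fun i => DF xi ord0 i)
      (fun i u => g u ord0 i))//; last by move=> i; have [] := ig s t i s0 tT.
    rewrite -(opprB (F (Theta t))) Fc /edot -sumrN; apply: eq_bigr => i _.
    have [_ ig0] := ig s t i s0 tT.
    rewrite !mxE -mulrN Thetag ?(le_trans s0 st)// (Thetag s) ?s0 ?(le_trans st)//.
    by rewrite Rintegral_itv0B ?s0//; ring.
  by rewrite /H; ring.
have iB : mu.-integrable `]s, t] (EFin \o (fun u => w u - edot (DF xi) (g u))).
  have := @integrableB _ _ R mu _ mst _ _ iw1 ix.
  by rewrite [X in _.-integrable _ X -> _](_ : _ =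
    EFin \o (fun u => w u - edot (DF xi) (g u))); first by apply.
rewrite (le_trans (@le_normr_Rintegral _ _ _ mu _ _ mst iB))//.
have mustE : fine (mu `]s, t]%classic) = t - s.
  rewrite lebesgue_measure_itv/= lte_fin; case: ltP => //= ts.
  by have -> : s = t by [apply: le_anti; rewrite st]; rewrite subrr.
rewrite -mustE -Rintegral_cst//; apply: le_Rintegral => //.
- exact: integrable_norm.
- apply: (@bounded_Rintegrable _ _ _ mu _ _ _ _ `|e * M *+ d|) => //.
  rewrite (le_lt_trans _ (lebesgue_itv_fin R s t))// le_measure ?inE//.
  by apply: subset_itv; rewrite bnd_simp.
- move=> u; rewrite /= in_itv/= => /andP[su ut].
  have -> : w u - edot (DF xi) (g u) = edot (DF (Theta u) - DF xi) (g u).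
    rewrite /w /edot -sumrB; apply: eq_bigr => i _.
    by rewrite !mxE mulrBl.
  apply: edot_bound => i.
    by rewrite (le_trans (coord_le_norm _ _))// De// ltW.
  by apply: gM; rewrite (le_trans s0 (ltW su)) (le_trans ut).
Qed.

(** [Theta] need not be differentiable where [g] jumps, so neither summand of [H] need be. Their sum
    is flat at every [x] all the same: near [x], the curve and its chords stay in a ball on which
    [DF] is almost constant. *)
Lemma gradient_chain_rule : F (Theta T) =
  F (Theta 0) - \int[lebesgue_measure]_(s in `[0, T]) edot (DF (Theta s)) (g s).
Proof.
suff : H T = H 0.
  rewrite /H set_itv1 Rintegral_set1 addr0 => <-.
  by rewrite addrK.
apply: locally_flat_cst => // x e xT e0.
have K0 : 0 < `|M| *+ d + 1 by rewrite ltr_wpDl// mulrn_wge0.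
(* [e1] compensates the factor [M *+ d] of [H_increment]; the summand 1 keeps the denominator
   positive. *)
pose e1 := e / (`|M| *+ d + 1).
have e10 : 0 < e1 by rewrite divr_gt0.
have e1M : e1 * M *+ d <= e.
  rewrite -mulrnAr /e1 mulrAC ler_pdivrMr// ler_pM2l//.
  by rewrite (@le_trans _ _ (`|M| *+ d))// ?lerDl// lerMn2r ler_norm orbT.
(* One half for the gradient on the curve and one for the gradient on the chord, both compared with
   [DF (Theta x)]. *)
have e120 : 0 < e1 / 2 by rewrite divr_gt0.
have /cvgrPdist_lt/(_ _ e120) /nbhs_normP[eta /= eta0 etaP] := cDF (Theta x).
have /subspace_continuousP/(_ x) := cTheta.
rewrite /= in_itv/= => /(_ xT)/cvgrPdist_lt/(_ _ eta0).
rewrite near_withinE => /nbhs_normP[r /= r0 rP]; exists r => //.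
have Thr u : 0 <= u <= T -> `|u - x| < r -> `|Theta x - Theta u| < eta.
  by move=> uT ur; apply: rP; rewrite /= ?in_itv//= distrC.
have incr s t : 0 <= s <= t -> t <= T -> `|s - x| < r -> `|t - x| < r ->
    `|H t - H s| <= e * (t - s).
  move=> /andP[s0 st] tT sr tr.
  rewrite (le_trans (H_increment s t e1 _ tT (ltW e10) _)) ?s0//; last first.
    by rewrite ler_wpM2r// subr_ge0.
  move=> c u /andP[c0 c1] /andP[su ut].
  have ur : `|u - x| < r.
    move: sr tr; rewrite !ltr_norml => /andP[? ?] /andP[? ?].
    by apply/andP; split; lra.
  have xir : `|Theta x - (Theta s + c *: (Theta t - Theta s))| < eta.
    (* Convexity of the ball around [Theta x]: a point of the chord is a convex combination of two
       points of the ball. *)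
    have -> : Theta x - (Theta s + c *: (Theta t - Theta s)) =
        (1 - c) *: (Theta x - Theta s) + c *: (Theta x - Theta t).
      by apply/rowP => i; rewrite !mxE; ring.
    rewrite (le_lt_trans (ler_normD _ _))// !normrZ !ger0_norm ?subr_ge0//.
    have := Thr s; rewrite s0 (le_trans st tT) => /(_ isT sr) h1.
    have := Thr t; rewrite (le_trans s0 st) tT => /(_ isT tr) h2.
    set m := Num.max `|Theta x - Theta s| `|Theta x - Theta t|.
    rewrite (@le_lt_trans _ _ ((1 - c) * m + c * m))//.
      by rewrite lerD// ler_wpM2l ?subr_ge0// /m le_max lexx ?orbT.
    by rewrite -mulrDl subrK mul1r gt_max h1.
  have h1 := etaP _ xir.
  have uT : 0 <= u <= T by rewrite (le_trans s0 su) (le_trans ut).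
  have h2 := etaP _ (Thr u uT ur).
  rewrite -(subrKA (DF (Theta x))) (le_trans (ler_normD _ _))//.
  rewrite distrC (splitr e1) ltW// ltrD//.
case/andP: xT => x0 xT y /andP[y0 yT] yr.
have xr : `|x - x| < r by rewrite subrr normr0.
have [xy|/ltW yx] := leP x y.
  by rewrite (@ger0_norm _ (y - x)) ?subr_ge0// incr// x0.
by rewrite distrC (distrC y) (@ger0_norm _ (x - y)) ?subr_ge0// incr// y0.
Qed.

End gradient_chain_rule.

(** * Networks, their derivatives, and the risk *)

Lemma cvg_sum_ord (R : realType) (U : Type) (F : set_system U) {FF : Filter F} n
    (f : 'I_n -> U -> R) (a : 'I_n -> R) :
  (forall i, f i u @[u --> F] --> a i) ->
  \sum_(i < n) f i u @[u --> F] --> \sum_(i < n) a i.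
Proof.
elim: n f a => [|n IH] f a fa.
  by rewrite big_ord0; under eq_fun do rewrite big_ord0; exact: cvg_cst.
rewrite big_ord_recr; under eq_fun do rewrite big_ord_recr.
by apply: cvgD; [apply: IH => i; exact: fa|exact: fa].
Qed.

Section network.
Context (R : realType) (l : nat -> nat) (d : nat).
Local Notation V := 'rV[R]_d.
Local Notation net := (net R l d).
Local Notation wgt := (wgt R l d).
Local Notation bia := (bia R l d).
Local Notation coord := (Defs.coord R d).

(* Forward-mode differentiation: the derivative of [net] at [th] in the
   direction [v], when [dsig k] is the derivative of [sig k]. *)
Fixpoint dnet (th v : V) (sig dsig : nat -> R -> R) (x : 'rV[R]_(l 0%N))
    (k i : nat) {struct k} : R :=
  match k with
  | 0%N => 0
  | k'.+1 =>
    match k' with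
    | 0%N => bia v 1 i + \sum_(j < l 0%N) wgt v 1 i j * x ord0 j
    | _.+1 => bia v k i + \sum_(j < l k')
        (wgt v k i j * sig k' (net th sig x k' j) +
         wgt th k i j * (dsig k' (net th sig x k' j) *
                         dnet th v sig dsig x k' j))
    end
  end.

Lemma net1 th sig x i : net th sig x 1 i =
  bia th 1 i + \sum_(j < l 0%N) wgt th 1 i j * x ord0 j.
Proof. by []. Qed.

Lemma netS th sig x k i : (0 < k)%N -> net th sig x k.+1 i =
  bia th k.+1 i + \sum_(j < l k) wgt th k.+1 i j * sig k (net th sig x k j).
Proof. by case: k. Qed.

Lemma dnetS th v sig dsig x k i : (0 < k)%N -> dnet th v sig dsig x k.+1 i =
  bia v k.+1 i + \sum_(j < l k)
    (wgt v k.+1 i j * sig k (net th sig x k j) +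
     wgt th k.+1 i j * (dsig k (net th sig x k j) * dnet th v sig dsig x k j)).
Proof. by case: k. Qed.

(** Layer 1 acts on the input without an activation, so the recursion proper starts there; the value
    at layer 0 is a placeholder. *)
Lemma net_ind (P : nat -> Prop) :
  P 0%N -> P 1%N -> (forall k, (0 < k)%N -> P k -> P k.+1) -> forall k, P k.
Proof. by move=> P0 P1 PS; elim=> // -[//|k] /PS; exact. Qed.

Lemma coordD u v c m : coord (u + c *: v) m = coord u m + c * coord v m.
Proof.
by rewrite /Defs.coord; case: insub => [i|]; rewrite ?mxE// mulr0 addr0.
Qed.

Lemma wgtD u v c k i j : wgt (u + c *: v) k i j = wgt u k i j + c * wgt v k i j.
Proof. exact: coordD. Qed.

Lemma biaD u v c k i : bia (u + c *: v) k i = bia u k i + c * bia v k i.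
Proof. exact: coordD. Qed.

Lemma coord_norm (v : V) m : `|coord v m| <= `|v|.
Proof.
rewrite /Defs.coord; case: insub => [i|]; last by rewrite normr0.
exact: coord_le_norm.
Qed.

Lemma dnetD th u v c sig dsig x k i : dnet th (u + c *: v) sig dsig x k i =
  dnet th u sig dsig x k i + c * dnet th v sig dsig x k i.
Proof.
elim/net_ind: k i => [|i|k k0 IH i]; first by rewrite /= mulr0 addr0.
  rewrite /= biaD mulrDr mulr_sumr addrACA -big_split/=; congr (_ + _).
  by apply: eq_bigr => j _; rewrite wgtD; ring.
rewrite !dnetS// biaD mulrDr mulr_sumr addrACA -big_split/=; congr (_ + _).
by apply: eq_bigr => j _; rewrite wgtD IH; ring.
Qed.

(** Common to ReLU and all its smoothings, so that the bounds on networks do not depend on the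
    smoothing parameter. *)
Definition subidentity (sig : nat -> R -> R) := forall k y, `|sig k y| <= `|y|.
Definition bounded_by (K : R) (dsig : nat -> R -> R) :=
  forall k y, `|dsig k y| <= K.

Lemma net_bound (M K X : R) k : exists2 C : R, 0 <= C &
  forall (sig dsig : nat -> R -> R) (th v : V) (x : 'rV[R]_(l 0%N)) i,
  subidentity sig -> bounded_by K dsig ->
  `|th| <= M -> `|v| <= M -> (forall j, `|x ord0 j| <= X) ->
  `|net th sig x k i| <= C /\ `|dnet th v sig dsig x k i| <= C.
Proof.
elim/net_ind: k => [||k k0 [C C0 IH]].
- by exists 0 => // *; rewrite normr0.
- exists (`|M| + (`|M| * `|X|) *+ l 0%N).
    by rewrite addr_ge0// mulrn_wge0// mulr_ge0.
  move=> sig dsig th v x i _ _ thM vM xX.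
  have h (u : V) : `|u| <= M ->
      `|bia u 1 i + \sum_(j < l 0%N) wgt u 1 i j * x ord0 j| <=
      `|M| + (`|M| * `|X|) *+ l 0%N.
    move=> uM; have uM' m : `|coord u m| <= `|M|.
      by rewrite (le_trans (coord_norm _ _))// (le_trans uM)// ler_norm.
    rewrite (le_trans (ler_normD _ _))// lerD//; first exact: uM'.
    rewrite (le_trans (ler_norm_sum _ _ _))//.
    rewrite -[l 0%N in leRHS]card_ord -sumr_const; apply: ler_sum => j _.
    rewrite normrM ler_pM//; first exact: uM'.
    by rewrite (le_trans (xX j))// ler_norm.
  by split; exact: h.
- exists (`|M| + (`|M| * C + `|M| * (`|K| * C)) *+ l k).
    by rewrite addr_ge0// mulrn_wge0// addr_ge0// !mulr_ge0.
  move=> sig dsig th v x i sigP dsigP thM vM xX.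
  have uM' u m : `|u| <= M -> `|coord u m| <= `|M|.
    by move=> uM; rewrite (le_trans (coord_norm _ _))// (le_trans uM)// ler_norm.
  have IH' j := IH sig dsig th v x j sigP dsigP thM vM xX.
  have sC j : `|sig k (net th sig x k j)| <= C.
    by rewrite (le_trans (sigP _ _))//; have [] := IH' j.
  rewrite netS// dnetS//; split.
    rewrite (le_trans (ler_normD _ _))// lerD//; first exact: uM'.
    rewrite (le_trans (ler_norm_sum _ _ _))//.
    rewrite -[l k in leRHS]card_ord -sumr_const; apply: ler_sum => j _.
    rewrite normrM (@le_trans _ _ (`|M| * C))//; first by rewrite ler_pM// uM'.
    by rewrite lerDl !mulr_ge0.
  rewrite (le_trans (ler_normD _ _))// lerD//; first exact: uM'.
  rewrite (le_trans (ler_norm_sum _ _ _))//.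
  rewrite -[l k in leRHS]card_ord -sumr_const; apply: ler_sum => j _.
  rewrite (le_trans (ler_normD _ _))// lerD// !normrM; first by rewrite ler_pM// uM'.
  rewrite ler_pM// ?uM'// ler_pM//; last by have [] := IH' j.
  by rewrite (le_trans (dsigP _ _))// ler_norm.
Qed.

(** Each weight contributes a factor 2 and the output below a factor [2 k], which passes through the
    activation by [dsig k y * y = sig k y]; together they make [2 (k + 1)], the factor prescribed
    for the bias. The shift [e] sits at layer [K] only, so it never passes through an activation. *)
Lemma dnet_homogeneous (sig dsig : nat -> R -> R) (th v : V) x (e : nat -> R) K :
  (forall k y, dsig k y * y = sig k y) ->
  (forall k i j, (0 < k <= K)%N -> (i < l k)%N -> (j < l k.-1)%N ->
     wgt v k i j = 2 * wgt th k i j) ->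
  (forall k i, (0 < k <= K)%N -> (i < l k)%N ->
     bia v k i = 2 * k%:R * bia th k i - (if k == K then e i else 0)) ->
  forall k i, (0 < k <= K)%N -> (i < l k)%N ->
  dnet th v sig dsig x k i =
  2 * k%:R * net th sig x k i - (if k == K then e i else 0).
Proof.
move=> hsig hw hb; elim/net_ind => // [i k0|k k0 IH i kK il].
  rewrite net1 [dnet _ _ _ _ _ _ _]/= => il.
  rewrite hb// mulrDr mulr_sumr addrAC; congr (_ + _ + _).
  by apply: eq_bigr => j _; rewrite hw//; ring.
rewrite dnetS// netS// hb// mulrDr mulr_sumr addrAC; congr (_ + _ + _).
apply: eq_bigr => j _; rewrite hw// IH ?k0 ?(ltnW (proj2 (andP kK)))//.
rewrite [k == K]ltn_eqF//.
rewrite subr0 -hsig -[in k.+1%:R]addn1 natrD; ring.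
Qed.

Section line_derivative.
Variables (sig dsig : nat -> R -> R).
Hypothesis sigD : forall k y, (0 < k)%N -> is_derive y (1 : R) (sig k) (dsig k y).

Lemma is_derive_affine (a b h : R) :
  is_derive h (1 : R) (fun k : R => a + k * b) b.
Proof.
have -> : (fun k : R => a + k * b) = cst a + id * cst b by [].
by apply: is_derive_eq; rewrite /= /GRing.scale/=; ring.
Qed.

Lemma is_derive_net (th v : V) x k i (h : R) :
  is_derive h (1 : R) (fun k' => net (th + k' *: v) sig x k i)
    (dnet (th + h *: v) v sig dsig x k i).
Proof.
elim/net_ind: k i => [i|i|k k0 IH i]; first exact: (is_derive_cst (0 : R)).
  rewrite (_ : (fun _ => _) = fun t => (bia th 1 i + t * bia v 1 i) +
      \sum_(j < l 0%N) (wgt th 1 i j * x ord0 j + t * (wgt v 1 i j * x ord0 j))).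
    apply: is_deriveD; first exact: is_derive_affine.
    rewrite -fct_sumE; apply: is_derive_sum => j; exact: is_derive_affine.
  apply/funext => t; rewrite net1 biaD; congr (_ + _).
  by apply: eq_bigr => j _; rewrite wgtD mulrDl mulrA.
rewrite dnetS// (_ : (fun _ => _) = fun t => (bia th k.+1 i + t * bia v k.+1 i) +
    \sum_(j < l k) (wgt th k.+1 i j + t * wgt v k.+1 i j) *
      sig k (net (th + t *: v) sig x k j)); last first.
  apply/funext => t; rewrite netS// biaD; congr (_ + _).
  by apply: eq_bigr => j _; rewrite wgtD.
apply: is_deriveD; first exact: is_derive_affine.
rewrite -fct_sumE; apply: is_derive_sum => j.
have h1 := is_derive_affine (wgt th k.+1 i j) (wgt v k.+1 i j) h.
have h2 := @is_derive1_comp R (sig k) _ h _ _ (sigD _ _ k0) (IH j).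
apply: is_derive_eq (is_deriveM h1 h2) _.
by rewrite wgtD /= /GRing.scale/=; ring.
Qed.

End line_derivative.

Section measurability.
Variables (sig dsig : nat -> R -> R).
Hypothesis msig : forall k, measurable_fun setT (sig k).
Hypothesis mdsig : forall k, measurable_fun setT (dsig k).

Lemma measurable_coordinate n (j : 'I_n) :
  measurable_fun setT (fun x : borelRn R n => x ord0 j).
Proof.
apply: (measurability _ (RGenOpens.measurableE R)).
move=> _ [_ [a [b ->] <-]]; rewrite setTI; apply: sub_sigma_algebra.
have /continuousP := @coord_continuous R 1 n ord0 j; apply.
exact: interval_open.
Qed.

Lemma measurable_cube n (a b : R) :
  measurable (cube R n a b : set (borelRn R n)).
Proof.
rewrite (_ : cube R n a b = \bigcap_(j in [set: 'I_n])
   ((fun x : borelRn R n => x ord0 j) @^-1` `[a, b]%classic)).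
  apply: fin_bigcap_measurable => [|j _]; first exact: finite_finset.
  by rewrite -[X in measurable X]setTI; apply: measurable_coordinate.
apply/seteqP; split => [x h j _|x h j]; rewrite /= ?in_itv; first exact: h.
by have := h j I; rewrite /= in_itv.
Qed.

Lemma measurable_net th k i : measurable_fun setT
  (fun x : borelRn R (l 0%N) => net th sig x k i).
Proof.
elim/net_ind: k i => [i|i|k k0 IH i]; first exact: measurable_cst.
  apply: measurable_funD; first exact: measurable_cst.
  apply: measurable_sum => j; apply: measurable_funM; first exact: measurable_cst.
  exact: measurable_coordinate.
under eq_fun do rewrite netS//.
apply: measurable_funD; first exact: measurable_cst.
apply: measurable_sum => j; apply: measurable_funM; first exact: measurable_cst.
exact: measurableT_comp.
Qed.

Lemma measurable_dnet th v k i : measurable_fun setT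
  (fun x : borelRn R (l 0%N) => dnet th v sig dsig x k i).
Proof.
elim/net_ind: k i => [i|i|k k0 IH i]; first exact: measurable_cst.
  apply: measurable_funD; first exact: measurable_cst.
  apply: measurable_sum => j; apply: measurable_funM; first exact: measurable_cst.
  exact: measurable_coordinate.
under eq_fun do rewrite dnetS//.
apply: measurable_funD; first exact: measurable_cst.
apply: measurable_sum => j; apply: measurable_funD.
  apply: measurable_funM; first exact: measurable_cst.
  by apply: measurableT_comp; [exact: msig|exact: measurable_net].
apply: measurable_funM; first exact: measurable_cst.
apply: measurable_funM => //.
by apply: measurableT_comp; [exact: mdsig|exact: measurable_net].
Qed.

End measurability.

Section convergence.
Context {U : Type} (F : set_system U) {FF : Filter F}.
Variables (thu vu : U -> V) (th v : V) (sigu dsigu : U -> nat -> R -> R)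
  (sig dsig : nat -> R -> R) (x : 'rV[R]_(l 0%N)).
Hypothesis cth : forall m, coord (thu u) m @[u --> F] --> coord th m.
Hypothesis cv : forall m, coord (vu u) m @[u --> F] --> coord v m.

Lemma cvg_net k i :
  (forall k yu y, (0 < k)%N -> yu u @[u --> F] --> y ->
     sigu u k (yu u) @[u --> F] --> sig k y) ->
  net (thu u) (sigu u) x k i @[u --> F] --> net th sig x k i.
Proof.
move=> csig; elim/net_ind: k i => [i|i|k k0 IH i]; first exact: cvg_cst.
  apply: cvgD; first exact: cth.
  by apply: cvg_sum_ord => j; apply: cvgM; [exact: cth|exact: cvg_cst].
rewrite netS//; under eq_fun do rewrite netS//.
apply: cvgD; first exact: cth.
by apply: cvg_sum_ord => j; apply: cvgM; [exact: cth|exact: csig].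
Qed.

(** Convergence of [dsigu] is required only at the outputs of the networks, and not along all
    convergent arguments as in [cvg_net]: the derivatives of the smoothed activations pass from 0 to
    1 arbitrarily close to 0, so they do not converge along every argument that tends to 0. *)
Lemma cvg_dnet k i :
  (forall k i, (0 < k)%N -> sigu u k (net (thu u) (sigu u) x k i) @[u --> F] -->
     sig k (net th sig x k i)) ->
  (forall k i, (0 < k)%N -> dsigu u k (net (thu u) (sigu u) x k i) @[u --> F] -->
     dsig k (net th sig x k i)) ->
  dnet (thu u) (vu u) (sigu u) (dsigu u) x k i @[u --> F] -->
  dnet th v sig dsig x k i.
Proof.
move=> csig cdsig; elim/net_ind: k i => [i|i|k k0 IH i]; first exact: cvg_cst.
  apply: cvgD; first exact: cv.
  by apply: cvg_sum_ord => j; apply: cvgM; [exact: cv|exact: cvg_cst].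
rewrite dnetS//; under eq_fun do rewrite dnetS//.
apply: cvgD; first exact: cv.
apply: cvg_sum_ord => j; apply: cvgD; first by apply: cvgM; [exact: cv|exact: csig].
by apply: cvgM; [exact: cth|apply: cvgM; [exact: cdsig|exact: IH]].
Qed.

End convergence.

End network.

Lemma cvg_rV (R : realType) (U : Type) (F : set_system U) {FF : Filter F} n
    (f : U -> 'rV[R]_n) (a : 'rV[R]_n) :
  (forall i, f u ord0 i @[u --> F] --> a ord0 i) -> f u @[u --> F] --> a.
Proof.
move=> fa; apply/cvg_ballP => e e0.
have : \forall u \near F, forall i, ball (a ord0 i) e (f u ord0 i).
  by apply: filter_forall => i; have /cvg_ballP := fa i; apply.
by apply: filterS => u fu; split => // i j; rewrite ord1; exact: fu.
Qed.

(** * Bounds and limits of the squared error risk and of its formal gradient *)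

Section risk.
Context (R : realType) (l : nat -> nat) (d L : nat) (a b : R).
Local Notation V := 'rV[R]_d.
Local Notation net := (net R l d).
Local Notation dnet := (dnet R l d).
Local Notation D := (cube R (l 0%N) a b : set (borelRn R (l 0%N))).
Variables (mu : {measure set (borelRn R (l 0%N)) -> \bar R}) (c : 'rV[R]_(l L)).
Hypothesis muD : (mu D < +oo)%E.

Definition sqerr (sig : nat -> R -> R) (th : V) (x : borelRn R (l 0%N)) : R :=
  \sum_(i < l L) (net th sig x L i - c ord0 i) ^+ 2.

Definition dsqerr (sig dsig : nat -> R -> R) (th v : V)
    (x : borelRn R (l 0%N)) : R :=
  \sum_(i < l L) 2 * (net th sig x L i - c ord0 i) * dnet th v sig dsig x L i.

Definition risk (sig : nat -> R -> R) (th : V) : R :=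
  \int[mu]_(x in D) sqerr sig th x.

Definition risk_grad (sig dsig : nat -> R -> R) (th : V) : V :=
  \row_m \int[mu]_(x in D) dsqerr sig dsig th (delta_mx 0 m) x.

Lemma sqerr_bound (M K : R) : exists2 C : R, 0 <= C &
  forall sig dsig th v x, subidentity R sig -> bounded_by R K dsig ->
  `|th| <= M -> `|v| <= M -> D x ->
  `|sqerr sig th x| <= C /\ `|dsqerr sig dsig th v x| <= C.
Proof.
have [C C0 CP] := net_bound R l d M K (`|a| + `|b|) L.
(* [C1] bounds each residual, since the sum dominates every coordinate of [c]; the constant chosen
   next covers the square and its derivative at once. *)
pose C1 := C + \sum_(i < l L) `|c ord0 i|.
have C10 : 0 <= C1 by rewrite addr_ge0// sumr_ge0.
exists ((C1 ^+ 2 + 2 * C1 * C) *+ l L).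
  by rewrite mulrn_wge0// addr_ge0 ?exprn_ge0// !mulr_ge0.
move=> sig dsig th v x sigP dsigP thM vM Dx.
have xX j : `|x ord0 j| <= `|a| + `|b|.
  have /andP[ax xb] := Dx j.
  rewrite ler_norml; apply/andP; split.
    rewrite lerNl -(lerD2r (`|b|)); have := ler_norm (- a); rewrite normrN.
    by have := normr_ge0 b; lra.
  by have := ler_norm b; have := normr_ge0 a; lra.
have h i := CP sig dsig th v x i sigP dsigP thM vM xX.
have h1 (i : 'I_(l L)) : `|net th sig x L i - c ord0 i| <= C1.
  rewrite (le_trans (ler_normB _ _))// lerD//; first by have [] := h i.
  by rewrite (bigD1 i)//= lerDl sumr_ge0.
split; rewrite (le_trans (ler_norm_sum _ _ _))//;
    rewrite -[l L in leRHS]card_ord -sumr_const; apply: ler_sum => i _.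
  rewrite normrX (@le_trans _ _ (C1 ^+ 2))//; last by rewrite lerDl !mulr_ge0.
  by rewrite lerXn2r ?nnegrE.
rewrite !normrM (@le_trans _ _ (2 * C1 * C))//; last by rewrite lerDr exprn_ge0.
rewrite ler_pM// ?mulr_ge0//; first by rewrite ger0_norm// ler_pM.
by have [] := h i.
Qed.

Lemma delta_norm i : `|delta_mx 0 i : V| <= 1.
Proof.
rewrite [`|_|]mx_normrE; apply/bigmax_leP; split => // -[k j] _ /=.
by rewrite mxE normr_nat lern1 leq_b1.
Qed.

Section fixed_activation.
Variables (K : R) (sig dsig : nat -> R -> R).
Hypotheses (sigP : subidentity R sig) (dsigP : bounded_by R K dsig).
Hypotheses (msig : forall k, measurable_fun setT (sig k))
  (mdsig : forall k, measurable_fun setT (dsig k)).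

Lemma measurable_sqerr th : measurable_fun D (sqerr sig th).
Proof.
apply: measurable_funTS; apply: measurable_sum => i; apply: measurable_funX.
by apply: measurable_funB; [exact: measurable_net|exact: measurable_cst].
Qed.

Lemma measurable_dsqerr th v : measurable_fun D (dsqerr sig dsig th v).
Proof.
apply: measurable_funTS; apply: measurable_sum => i; apply: measurable_funM.
  apply: measurable_funM; first exact: measurable_cst.
  by apply: measurable_funB; [exact: measurable_net|exact: measurable_cst].
exact: measurable_dnet.
Qed.

Lemma integrable_sqerr th : mu.-integrable D (EFin \o sqerr sig th).
Proof.
have [C _ CP] := sqerr_bound `|th| K.
apply: (bounded_Rintegrable _ _ _ _ _ _ _ _ C) => //.
- exact: measurable_cube.
- exact: measurable_sqerr.
- by move=> x Dx; have [] := CP sig dsig th th x sigP dsigP (lexx _) (lexx _) Dx.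
Qed.

Lemma integrable_dsqerr th v : mu.-integrable D (EFin \o dsqerr sig dsig th v).
Proof.
have [C _ CP] := sqerr_bound (`|th| + `|v|) K.
apply: (bounded_Rintegrable _ _ _ _ _ _ _ _ C) => //.
- exact: measurable_cube.
- exact: measurable_dsqerr.
- by move=> x Dx; have [] := CP sig dsig th v x sigP dsigP _ _ Dx;
    rewrite ?lerDl ?lerDr.
Qed.

Lemma dsqerr_lincomb th v x :
  dsqerr sig dsig th v x =
  \sum_(m < d) v ord0 m * dsqerr sig dsig th (delta_mx 0 m) x.
Proof.
have lin u w t : dsqerr sig dsig th (u + t *: w) x =
    dsqerr sig dsig th u x + t * dsqerr sig dsig th w x.
  rewrite /dsqerr mulr_sumr -big_split; apply: eq_bigr => i _ /=.
  by rewrite dnetD; ring.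
have lin0 : dsqerr sig dsig th 0 x = 0.
  by have := lin 0 0 1; rewrite scaler0 addr0 mul1r => h; lra.
rewrite {1}(row_sum_delta v).
elim/big_ind2 : _ => // [_ s _ t <- <-|i _].
  by have := lin s t 1; rewrite scale1r mul1r.
by have := lin 0 (delta_mx 0 i) (v ord0 i); rewrite !add0r lin0 add0r.
Qed.

Lemma edot_risk_grad th v :
  edot (risk_grad sig dsig th) v = \int[mu]_(x in D) dsqerr sig dsig th v x.
Proof.
under eq_Rintegral do rewrite dsqerr_lincomb.
rewrite (Rintegral_lincomb _ _ _ mu _ _ _ (fun m => v ord0 m)
  (fun m => dsqerr sig dsig th (delta_mx 0 m))).
- by apply: eq_bigr => m _; rewrite mxE mulrC.
- exact: measurable_cube.
- by move=> m; exact: integrable_dsqerr.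
Qed.

End fixed_activation.

Lemma Rintegral_bound (f : borelRn R (l 0%N) -> R) C : measurable_fun D f ->
  (forall x, D x -> `|f x| <= C) ->
  `|\int[mu]_(x in D) f x| <= C * fine (mu D).
Proof.
move=> mf fC; have mD := measurable_cube R (l 0%N) a b.
have fi := bounded_Rintegrable _ _ _ mu _ mD muD _ _ mf fC.
rewrite (le_trans (le_normr_Rintegral mD fi))// -Rintegral_cst//.
apply: le_Rintegral => //; first exact: integrable_norm.
by apply: (bounded_Rintegrable _ _ _ mu _ mD muD (cst C) `|C|).
Qed.

Lemma risk_grad_bound (M K : R) : exists2 C : R, 0 <= C &
  forall sig dsig th, subidentity R sig -> bounded_by R K dsig ->
  (forall k, measurable_fun setT (sig k)) ->
  (forall k, measurable_fun setT (dsig k)) ->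
  `|th| <= M -> forall i, `|risk_grad sig dsig th ord0 i| <= C.
Proof.
(* The maximum with 1 makes room for the directions [delta_mx 0 i], of norm at most 1. *)
have [C C0 CP] := sqerr_bound (Num.max M 1) K.
exists (C * fine (mu D)); first by rewrite mulr_ge0// fine_ge0.
move=> sig dsig th sigP dsigP ms mds thM i; rewrite mxE.
apply: Rintegral_bound; first exact: measurable_dsqerr.
move=> x Dx; have [] := CP sig dsig th (delta_mx 0 i) x sigP dsigP _ _ Dx => //.
  by rewrite le_max thM.
by rewrite le_max delta_norm orbT.
Qed.

(** Serves two limits: [u] tending to [th] with a fixed activation, for the continuity of the
    smoothed gradients, and [r] tending to infinity with [th] fixed, for the limit of these
    gradients. *)
Lemma cvg_risk_grad {U : Type} (F : set_system U) {FF : Filter F} B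
    (thu : U -> V) (th : V) (sigu dsigu : U -> nat -> R -> R) sig dsig M K :
  countably_based F B ->
  (forall m, Defs.coord R d (thu u) m @[u --> F] --> Defs.coord R d th m) ->
  (\forall u \near F, [/\ subidentity R (sigu u), bounded_by R K (dsigu u),
     forall k, measurable_fun setT (sigu u k) &
     forall k, measurable_fun setT (dsigu u k)]) ->
  (\forall u \near F, `|thu u| <= M) ->
  (forall x k i, (0 < k)%N -> net (thu u) (sigu u) x k i @[u --> F] -->
     net th sig x k i) ->
  (forall x k i, (0 < k)%N -> sigu u k (net (thu u) (sigu u) x k i) @[u --> F] -->
     sig k (net th sig x k i)) ->
  (forall x k i, (0 < k)%N -> dsigu u k (net (thu u) (sigu u) x k i) @[u --> F] -->
     dsig k (net th sig x k i)) ->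
  (0 < L)%N ->
  risk (sigu u) (thu u) @[u --> F] --> risk sig th /\
  risk_grad (sigu u) (dsigu u) (thu u) @[u --> F] --> risk_grad sig dsig th.
Proof.
move=> FB cth sP thM cn cs cd L0.
have [C C0 CP] := sqerr_bound (Num.max M 1) K.
have mD := measurable_cube R (l 0%N) a b.
split.
  apply: (Rintegral_cvg _ _ _ mu _ mD muD B _ _ C FB).
  - by apply: filterS sP => u [_ _ ms _]; exact: measurable_sqerr.
  - apply: filterS2 sP thM => u [su du _ _] uM x Dx.
    by have [] := CP (sigu u) (dsigu u) (thu u) (thu u) x su du _ _ Dx;
      rewrite ?le_max ?uM.
  - move=> x Dx; apply: cvg_sum_ord => i.
    under eq_fun do rewrite expr2; rewrite expr2.
    by apply: cvgM; apply: cvgB; (exact: cn || exact: cvg_cst).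
apply: cvg_rV => m; rewrite mxE; under eq_fun do rewrite mxE.
apply: (Rintegral_cvg _ _ _ mu _ mD muD B _ _ C FB).
- by apply: filterS sP => u [_ _ ms mds]; exact: measurable_dsqerr.
- apply: filterS2 sP thM => u [su du _ _] uM x Dx.
  by have [] := CP (sigu u) (dsigu u) (thu u) (delta_mx 0 m) x su du _ _ Dx;
    rewrite ?le_max ?uM ?delta_norm ?orbT.
- move=> x Dx; apply: cvg_sum_ord => i; apply: cvgM.
    apply: cvgM; first exact: cvg_cst.
    by apply: cvgB; [exact: cn|exact: cvg_cst].
  apply: cvg_dnet => //; first by move=> k; exact: cvg_cst.
  + exact: cs.
  + exact: cd.
Qed.

End risk.

(** * Differentiation of the risk under the integral sign *)

Section risk_derivative.
Context (R : realType) (l : nat -> nat) (d L : nat) (a b : R).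
Local Notation V := 'rV[R]_d.
Local Notation D := (cube R (l 0%N) a b : set (borelRn R (l 0%N))).
Variables (mu : {measure set (borelRn R (l 0%N)) -> \bar R}) (c : 'rV[R]_(l L)).
Hypothesis muD : (mu D < +oo)%E.
Variables (K : R) (sig dsig : nat -> R -> R).
Hypotheses (sigP : subidentity R sig) (dsigP : bounded_by R K dsig).
Hypotheses (msig : forall k, measurable_fun setT (sig k))
  (mdsig : forall k, measurable_fun setT (dsig k)).
Hypothesis sigD : forall k (y : R), (0 < k)%N -> is_derive y (1 : R) (sig k) (dsig k y).

Lemma is_derive_sqerr (th v : V) x (h : R) :
  is_derive h (1 : R) (fun k => sqerr R l d L c sig (th + k *: v) x)
    (dsqerr R l d L c sig dsig (th + h *: v) v x).
Proof.
rewrite /sqerr /dsqerr -fct_sumE; apply: is_derive_sum => i.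
have hn := is_derive_net R l d sig dsig sigD th v x L i h.
have hc := is_deriveB hn (is_derive_cst (c ord0 i) h (1 : R)).
rewrite subr0 in hc; rewrite -mulrA [X in is_derive _ _ _ X]mulr_natl mulr2n.
exact: (is_deriveM hc hc).
Qed.

Lemma risk_has_gradient :
  has_gradient R d (risk R l d L a b mu c sig) (risk_grad R l d L a b mu c sig dsig).
Proof.
move=> th v h.
have mD := measurable_cube R (l 0%N) a b.
rewrite (edot_risk_grad _ _ _ _ _ _ _ _ muD K)//.
pose f := fun (k : R) x => sqerr R l d L c sig (th + k *: v) x.
have fD k x : is_derive k (1 : R) (f ^~ x) (dsqerr R l d L c sig dsig (th + k *: v) v x).
  exact: is_derive_sqerr.
(* The bound covers [v] and all [th + k *: v] with [k] within distance 1 of [h], so [C] dominates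
   the partial derivatives on that interval. *)
have [C C0 CP] := sqerr_bound R l d L a b c (`|th| + (`|h| + 1) * `|v| + `|v|) K.
have hI : `]h - 1, h + 1[%classic h by rewrite /= in_itv/=; apply/andP; split; lra.
have fI k : `]h - 1, h + 1[%classic k -> mu.-integrable D (EFin \o f k).
  by move=> _; exact: (integrable_sqerr _ _ _ _ _ _ _ _ muD K sig dsig).
have fdiff k x : `]h - 1, h + 1[%classic k -> D x -> derivable (f ^~ x) k 1.
  by have [] := fD k x.
have intC : mu.-integrable D (EFin \o cst C).
  by apply: (bounded_Rintegrable _ _ _ mu _ mD muD (cst C) `|C|).
have Gub k x : `]h - 1, h + 1[%classic k -> D x -> `|partial1of2 f k x| <= C.
  rewrite /= in_itv/= => /andP[hk kh] Dx.
  rewrite partial1of2E (@derive_val _ _ _ _ _ _ _ (fD k x)).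
  have vM : `|v| <= `|th| + (`|h| + 1) * `|v| + `|v|.
    by rewrite lerDr addr_ge0// mulr_ge0// addr_ge0.
  have kM : `|th + k *: v| <= `|th| + (`|h| + 1) * `|v| + `|v|.
    rewrite (le_trans (ler_normD _ _))// -addrA lerD// normrZ ler_wpDr//.
    rewrite ler_wpM2r// ler_norml; have := ler_norm h; have := ler_norm (- h).
    by rewrite normrN => ? ?; apply/andP; split; lra.
  by have [] := CP sig dsig (th + k *: v) v x sigP dsigP kM vM Dx.
have cvgF := @cvg_differentiation_under_integral R _ _ mu f D mD h (h - 1) (h + 1)
  hI fI fdiff (cst C) (fun=> C0) intC Gub.
have {}cvgF : k^-1 *: (risk R l d L a b mu c sig (th + (k *: 1 + h) *: v) -
      risk R l d L a b mu c sig (th + h *: v)) @[k --> 0^'] -->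
      \int[mu]_(x in D) dsqerr R l d L c sig dsig (th + h *: v) v x.
    rewrite (@eq_Rintegral _ _ _ mu D (partial1of2 f h)); last first.
      by move=> x _; rewrite partial1of2E (@derive_val _ _ _ _ _ _ _ (fD h x)).
    by move: cvgF; under eq_fun do rewrite -[X in (X + h)]mulr1.
  split; first by apply/cvg_ex;
    exists (\int[mu]_(x in D) dsqerr R l d L c sig dsig (th + h *: v) v x).
  by apply/cvg_lim.
Qed.

End risk_derivative.

(** * From the smoothed activations to ReLU *)

Section root_asymptotics.
Context (R : realType).
Local Notation root k r := ((r : R) `^ (k%:R^-1)).

(** Includes [k = 0], where the inverse of 0 is 0 and the root is 1; hence the smoothed activations
    are well behaved at every index. *)
Lemma root_ge1 k (r : R) : 1 <= r -> 1 <= root k r.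
Proof. by move=> r1; rewrite -[leLHS](powRr0 r) ler_powR. Qed.

Lemma cvg_root k : (0 < k)%N -> root k r @[r --> +oo] --> +oo.
Proof.
move=> k0; apply/cvgryPge => M; near=> r.
have kR : (k%:R : R) != 0 by rewrite pnatr_eq0 -lt0n.
rewrite (le_trans (ler_norm M))//.
have -> : `|M| = root k (`|M| `^ k%:R).
  by rewrite -powRrM divff// powRr1.
rewrite ge0_ler_powR ?nnegrE ?powR_ge0//.
Unshelve. all: by end_near. Qed.

Lemma cvg_invroot k : (0 < k)%N -> (root k r)^-1 @[r --> +oo] --> (0 : R).
Proof.
move=> k0; apply/gtr0_cvgV0; last exact: cvg_root.
near=> r; rewrite (lt_le_trans ltr01)// root_ge1//.
Unshelve. all: by end_near. Qed.

(** The gap 1/k - 1/(k+1) = 1/(k(k+1)) between successive exponents is the power of [r] that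
    [net_rate] has to spare at each layer. *)
Lemma rootS k (r : R) : (0 < k)%N -> 0 < r ->
  root k.+1 r / root k r = (root (k * k.+1) r)^-1.
Proof.
move=> k0 r0; have kR : (k%:R : R) != 0 by rewrite pnatr_eq0 -lt0n.
have k1R : (k.+1%:R : R) != 0 by rewrite pnatr_eq0.
rewrite -powRB; last by rewrite (gt_eqF r0) /= implybT.
rewrite -powRN; congr powR.
rewrite natrM; move: k1R; rewrite -addn1 natrD => k1R; field.
by rewrite k1R kR.
Qed.

Lemma cvg_to_eq {U : Type} (F : set_system U) (f : U -> R) (a b : R) :
  a = b -> f u @[u --> F] --> a -> f u @[u --> F] --> b.
Proof. by move=> ->. Qed.

Lemma cvg0_dominated {U : Type} (F : set_system U) {FF : Filter F} (f g : U -> R) :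
  (\forall u \near F, `|f u| <= g u) -> g u @[u --> F] --> (0 : R) ->
  f u @[u --> F] --> (0 : R).
Proof.
move=> fg g0; apply: (@squeeze_cvgr _ _ _ _ (fun u => - g u) g) => //.
  by apply: filterS fg => u; rewrite ler_norml.
by rewrite -oppr0; exact: cvgN.
Qed.

End root_asymptotics.

Section activation.
Context (R : realType) (A B C : R) (Rr : R -> R -> R).
Hypotheses (A0 : 0 < A) (AB : A < B).
Hypothesis RrP : forall r, 1 <= r ->
  (forall x, derivable (Rr r) x 1) /\ continuous (derive1 (Rr r)) /\
  (forall x, x <= A / r -> Rr r x = 0) /\
  (forall y, 0 <= Rr r y <= Num.max y 0) /\
  (forall z, B / r <= z -> Rr r z = z).
Hypothesis RrC : forall r, 1 <= r -> forall x, `|(derive1 (Rr r)) x| <= C.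
Local Notation root k r := ((r : R) `^ (k%:R^-1)).

Definition dsig_fin (r : R) : nat -> R -> R :=
  fun k y => derive1 (Rr (root k r)) y.

(* The value 0 at the kink is the limit of the derivatives of the smoothed
   activations, as these vanish on a neighbourhood of 0. *)
Definition dsig_inf : nat -> R -> R := fun _ y => (0 < y)%R%:R.

Lemma subidentity_fin r : 1 <= r -> subidentity R (sig_fin R Rr r).
Proof.
move=> r1 k y; have [_ [_ [_ [bd _]]]] := RrP _ (root_ge1 _ k _ r1).
have /andP[y0 ym] := bd y; rewrite /sig_fin ger0_norm// (le_trans ym)//.
by rewrite ge_max ler_norm normr_ge0.
Qed.

Lemma subidentity_inf : subidentity R (sig_inf R).
Proof.
move=> k y; rewrite /sig_inf ger0_norm ?le_max ?lexx ?orbT//.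
by rewrite ge_max ler_norm normr_ge0.
Qed.

Lemma bounded_dsig_fin r : 1 <= r -> bounded_by R (Num.max C 1) (dsig_fin r).
Proof. by move=> r1 k y; rewrite le_max RrC// root_ge1. Qed.

Lemma bounded_dsig_inf : bounded_by R (Num.max C 1) dsig_inf.
Proof.
by move=> k y; rewrite /dsig_inf normr_nat le_max lern1 leq_b1 orbT.
Qed.

Lemma is_derive_sig_fin r k (y : R) : 1 <= r ->
  is_derive y (1 : R) (sig_fin R Rr r k) (dsig_fin r k y).
Proof.
move=> r1; have [dR _] := RrP _ (root_ge1 _ k _ r1).
by rewrite /dsig_fin derive1E; apply: derivableP; exact: dR.
Qed.

Lemma continuous_sig_fin r k : 1 <= r -> continuous (sig_fin R Rr r k).
Proof.
move=> r1 y; have [dR _] := is_derive_sig_fin r k y r1.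
by apply: differentiable_continuous; apply/derivable1_diffP.
Qed.

Lemma continuous_dsig_fin r k : 1 <= r -> continuous (dsig_fin r k).
Proof. by move=> r1; have [_ [cR _]] := RrP _ (root_ge1 _ k _ r1). Qed.

Lemma measurable_sig_fin r k : 1 <= r -> measurable_fun setT (sig_fin R Rr r k).
Proof. by move=> r1; apply: continuous_measurable_fun; exact: continuous_sig_fin. Qed.

Lemma measurable_dsig_fin r k : 1 <= r -> measurable_fun setT (dsig_fin r k).
Proof. by move=> r1; apply: continuous_measurable_fun; exact: continuous_dsig_fin. Qed.

Lemma measurable_sig_inf k : measurable_fun setT (sig_inf R k).
Proof. exact: measurable_maxr. Qed.

Lemma measurable_dsig_inf k : measurable_fun setT (dsig_inf k).
Proof.
rewrite (_ : dsig_inf k = \1_(`]0, +oo[%classic : set R)).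
  by apply: measurable_indic; exact: measurable_itv.
by apply/funext => y; rewrite indicE mem_setE in_itv/= andbT.
Qed.

(** Above [B / r] the smoothed activation is the identity; below, both it and ReLU take values
    between 0 and [B / r]. The second term is the Lipschitz bound for ReLU. *)
Lemma relu_error r (y z : R) : 1 <= r ->
  `|Rr r y - Num.max z 0| <= B / r + `|y - z|.
Proof.
move=> r1; have [_ [_ [_ [bd id]]]] := RrP _ r1.
have Br0 : 0 < B / r.
  by apply: divr_gt0; [exact: lt_trans AB|exact: lt_le_trans r1].

have /andP[] := bd y.
have := ler_norm (y - z); have := ler_norm (- (y - z)); rewrite normrN.
rewrite !ler_norml; have [yB|By] := leP (B / r) y.
  by rewrite (id _ yB); case: (leP y 0); case: (leP z 0) => *; apply/andP; split; lra.
by case: (leP y 0); case: (leP z 0) => *; apply/andP; split; lra.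
Qed.

Lemma derive_small r (y : R) : 1 <= r -> r * y < A -> derive1 (Rr r) y = 0.
Proof.
move=> r1 ryA; have [_ [_ [z0 _]]] := RrP _ r1.
have r0 : 0 < r by exact: lt_le_trans r1.
rewrite derive1E (@near_eq_derive _ _ _ _ (cst 0)) ?derive_cst//.
near=> x; apply: z0; rewrite ltW//; near: x; apply: lt_nbhsl.
by rewrite ltr_pdivlMr// mulrC.
Unshelve. all: by end_near. Qed.

Lemma derive_large r (y : R) : 1 <= r -> B < r * y -> derive1 (Rr r) y = 1.
Proof.
move=> r1 Bry; have [_ [_ [_ [_ zz]]]] := RrP _ r1.
have r0 : 0 < r by exact: lt_le_trans r1.
rewrite derive1E (@near_eq_derive _ _ _ _ id) ?derive_id//.
near=> x; apply: zz; rewrite ltW//; near: x; apply: lt_nbhsr.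
by rewrite ltr_pdivrMr// mulrC.
Unshelve. all: by end_near. Qed.

Section rate.
Variables (l : nat -> nat) (d : nat) (th : 'rV[R]_d) (x : 'rV[R]_(l 0%N)).
Local Notation yr r := (net R l d th (sig_fin R Rr r) x).
Local Notation yi := (net R l d th (sig_inf R) x).

(* This rate is the reason for the exponents 1/k: the error of layer k, caused
   by the layers below, is negligible against the width of the interval on
   which the activation of layer k is smoothed. *)
Lemma net_rate k i : (0 < k)%N ->
  root k r * (yr r k i - yi k i) @[r --> +oo] --> (0 : R).
Proof.
elim/net_ind: k i => [//|i _|k k0 IH i _].
  by under eq_fun do rewrite !net1 subrr mulr0; exact: cvg_cst.
have {}IH j := IH j k0.
(* The biases cancel, which leaves the activation errors of the layer below. *)
have -> : (fun r => root k.+1 r * (yr r k.+1 i - yi k.+1 i)) =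
    fun r => \sum_(j < l k) wgt R l d th k.+1 i j *
      (root k.+1 r * (sig_fin R Rr r k (yr r k j) - sig_inf R k (yi k j))).
  apply/funext => r; rewrite !netS// opprD addrACA subrr add0r -sumrB mulr_sumr.
  by apply: eq_bigr => j _; ring.
apply: (@cvg_to_eq _ _ _ _ (\sum_(j < l k) wgt R l d th k.+1 i j * 0)).
  by rewrite big1// => j _; rewrite mulr0.
apply: cvg_sum_ord => j; apply: cvgM; first exact: cvg_cst.
(* Factoring the inverse of [root k r] out of the bound of [relu_error] leaves a bracket that
   converges by induction, and the quotient of roots in front of it tends to 0 by [rootS]. *)
apply: (@cvg0_dominated _ _ _ _ _ (fun r => (root (k * k.+1) r)^-1 *
  (B + `|root k r * (yr r k j - yi k j)|))); last first.
  apply: (@cvg_to_eq _ _ _ _ (0 * (B + `|0|))); first by rewrite mul0r.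
  apply: cvgM; first by apply: cvg_invroot; rewrite muln_gt0 k0.
  by apply: cvgD; [exact: cvg_cst|apply: cvg_norm; exact: IH].
near=> r; have r1 : 1 <= r by near: r; exact: nbhs_pinfty_ge.
have r0 : 0 < r by exact: lt_le_trans r1.
have p0 m : 0 < root m r by rewrite powR_gt0.
rewrite -rootS// normrM gtr0_norm// -mulrA ler_pM2l// mulrDr normrM.
rewrite (gtr0_norm (p0 k)) mulKf ?gt_eqF// (mulrC _ B).
exact: relu_error (root_ge1 _ k _ r1).
Unshelve. all: by end_near. Qed.

Lemma cvg_net_fin k i : (0 < k)%N -> yr r k i @[r --> +oo] --> yi k i.
Proof.
move=> k0; apply: (@cvg_to_eq _ _ _ _ (0 + yi k i)); first by rewrite add0r.
have -> : (fun r => yr r k i) = fun r => (yr r k i - yi k i) + yi k i.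
  by apply/funext => r; rewrite subrK.
apply: cvgD; last exact: cvg_cst.
apply: (@cvg0_dominated _ _ _ _ _ (fun r => (root k r)^-1 *
  `|root k r * (yr r k i - yi k i)|)); last first.
  apply: (@cvg_to_eq _ _ _ _ (0 * `|0|)); first by rewrite mul0r.
  apply: cvgM; first exact: cvg_invroot.
  by apply: cvg_norm; exact: net_rate.
near=> r; have p0 : 0 < root k r by rewrite powR_gt0//; near: r; exact: nbhs_pinfty_gt.
by rewrite normrM (gtr0_norm p0) mulKf ?gt_eqF.
Unshelve. all: by end_near. Qed.

Lemma cvg_sig_net_fin k i : (0 < k)%N ->
  sig_fin R Rr r k (yr r k i) @[r --> +oo] --> sig_inf R k (yi k i).
Proof.
move=> k0; apply: (@cvg_to_eq _ _ _ _ (0 + sig_inf R k (yi k i))).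
  by rewrite add0r.
have -> : (fun r => sig_fin R Rr r k (yr r k i)) =
    fun r => (sig_fin R Rr r k (yr r k i) - sig_inf R k (yi k i)) + sig_inf R k (yi k i).
  by apply/funext => r; rewrite subrK.
apply: cvgD; last exact: cvg_cst.
apply: (@cvg0_dominated _ _ _ _ _ (fun r => B * (root k r)^-1 +
  `|yr r k i - yi k i|)); last first.
  apply: (@cvg_to_eq _ _ _ _ (B * 0 + `|yi k i - yi k i|)).
    by rewrite subrr normr0 mulr0 addr0.
  apply: cvgD; first by apply: cvgM; [exact: cvg_cst|exact: cvg_invroot].
  by apply: cvg_norm; apply: cvgB; [exact: cvg_net_fin|exact: cvg_cst].
near=> r; apply: relu_error; apply: root_ge1.
by near: r; exact: nbhs_pinfty_ge.
Unshelve. all: by end_near. Qed.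

(** If the limit is positive, [root k r] times the output tends to infinity and passes [B]. If it is
    at most 0, this product is at most the scaled error of [net_rate], hence eventually below [A].
    This settles the limit 0, where convergence of the outputs alone would not tell on which side of
    the smoothed interval they lie. *)
Lemma cvg_dsig_net_fin k i : (0 < k)%N ->
  dsig_fin r k (yr r k i) @[r --> +oo] --> dsig_inf k (yi k i).
Proof.
move=> k0; rewrite /dsig_inf; apply: cvg_near_cst.
have /cvgr0Pnorm_lt h := net_rate k i k0.
have hA := h _ A0; have h1 := h _ ltr01.
have [yi0|yi0] := ltP 0 (yi k i).
  near=> r; have r1 : 1 <= r by near: r; exact: nbhs_pinfty_ge.
  apply: derive_large; first exact: root_ge1.
  have : `|root k r * (yr r k i - yi k i)| < 1 by near: r; exact: h1.
  (* With numerator [B + 1], more than [B] is left after a scaled error below 1. *)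
  have : (B + 1) / yi k i <= root k r.
    by near: r; move: (cvg_root R k k0) => /cvgryPge; apply.
  rewrite ler_pdivrMr// ltr_norml mulrBr => ? /andP[? ?]; lra.
near=> r; have r1 : 1 <= r by near: r; exact: nbhs_pinfty_ge.
apply: derive_small; first exact: root_ge1.
have : `|root k r * (yr r k i - yi k i)| < A by near: r; exact: hA.
have : root k r * yi k i <= 0 by rewrite mulr_ge0_le0// powR_ge0.
rewrite ltr_norml mulrBr => ? /andP[? ?]; lra.
Unshelve. all: by end_near. Qed.

End rate.
End activation.

(** * The Lyapunov function *)

Section layer_indexing.
Variable l : nat -> nat.

Lemma ddS k : dd l k.+1 = (dd l k + (l k.+1 * l k + l k.+1))%N.
Proof. by rewrite /dd big_nat_recr//= mulnDr muln1. Qed.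

Lemma dd0 : dd l 0 = 0%N.
Proof. by rewrite /dd big_geq. Qed.

Lemma leq_dd k K : (k <= K)%N -> (dd l k <= dd l K)%N.
Proof.
move=> /subnK <-; elim: (K - k)%N => // m IH.
by rewrite addSn ddS (leq_trans IH)// leq_addr.
Qed.

Context (R : realType).

Lemma sum_ord_mul n p (F : nat -> R) :
  \sum_(m < n * p) F m = \sum_(i < n) \sum_(j < p) F (i * p + j)%N.
Proof.
elim: n => [|n IH]; first by rewrite !big_ord0.
by rewrite mulSnr big_split_ord/= IH big_ord_recr.
Qed.

(** The layout of the parameter vector: in the block of layer [k] the weights come first, row by
    row, and then the biases. This turns V into a sum over a single index. *)
Lemma sum_layers K (F : nat -> R) :
  \sum_(m < dd l K) F m = \sum_(1 <= k < K.+1)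
    (\sum_(i < l k) F (l k * l k.-1 + i + dd l k.-1)%N +
     \sum_(i < l k) \sum_(j < l k.-1) F (i * l k.-1 + j + dd l k.-1)%N).
Proof.
elim: K => [|K IH]; first by rewrite dd0 big_ord0 big_geq.
rewrite ddS big_split_ord/= IH [RHS]big_nat_recr//=; congr (_ + _).
rewrite big_split_ord/= addrC; congr (_ + _).
  by apply: eq_bigr => i _; rewrite addnC.
rewrite (sum_ord_mul _ _ (fun m => F (dd l K + m)%N)).
by apply: eq_bigr => i _; apply: eq_bigr => j _; rewrite addnC.
Qed.

(* Coefficient of the square of the m-th parameter in V: 1 for a weight, and k
   for a bias of layer k. *)
Fixpoint Vcoef (K m : nat) : nat :=
  if K is k.+1 then
    if (m < dd l k)%N then Vcoef k m
    else if (m < l K * l k + dd l k)%N then 1%N else K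
  else 0%N.

Lemma VcoefE K k m : (0 < k <= K)%N -> (dd l k.-1 <= m < dd l k)%N ->
  Vcoef K m = if (m < l k * l k.-1 + dd l k.-1)%N then 1%N else k.
Proof.
case: k => // k /= kK /andP[km mk].
elim: K kK => // K IH; rewrite ltnS leq_eqVlt => /predU1P[<-|kK] /=.
  by rewrite ltnNge km.
by rewrite (leq_trans mk (leq_dd _ _ kK)) IH.
Qed.

Lemma weight_index k i j : (0 < k)%N -> (i < l k)%N -> (j < l k.-1)%N ->
  (dd l k.-1 <= i * l k.-1 + j + dd l k.-1 < l k * l k.-1 + dd l k.-1)%N.
Proof.
move=> k0 ik jk; rewrite leq_addl/= ltn_add2r.
by rewrite (@leq_trans (i.+1 * l k.-1))// ?leq_mul2r ?ik ?orbT// mulSnr ltn_add2l.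
Qed.

Lemma bias_index k i : (0 < k)%N -> (i < l k)%N ->
  (l k * l k.-1 + dd l k.-1 <= l k * l k.-1 + i + dd l k.-1 < dd l k)%N.
Proof.
case: k => // k _ ik /=.
by rewrite ddS addnAC leq_addr/= addnCA addnA ltn_add2l.
Qed.

Lemma first_bias_index k : (0 < k)%N -> (l k * l k.-1 + dd l k.-1 <= dd l k)%N.
Proof. by case: k => // k _; rewrite ddS addnA (addnC (dd l k)) leq_addr. Qed.

Lemma Vcoef_weight K k i j : (0 < k <= K)%N -> (i < l k)%N -> (j < l k.-1)%N ->
  Vcoef K (i * l k.-1 + j + dd l k.-1) = 1%N.
Proof.
move=> kK ik jk; have k0 : (0 < k)%N by case/andP: kK.
have /andP[h1 h2] := weight_index k i j k0 ik jk.
by rewrite (VcoefE _ k) ?h1 ?h2// (leq_trans h2)// first_bias_index.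
Qed.

Lemma Vcoef_bias K k i : (0 < k <= K)%N -> (i < l k)%N ->
  Vcoef K (l k * l k.-1 + i + dd l k.-1) = k.
Proof.
move=> kK ik; have k0 : (0 < k)%N by case/andP: kK.
have /andP[h1 h2] := bias_index k i k0 ik.
by rewrite (VcoefE _ k) ?h2 ?andbT// ?ltnNge ?h1// (leq_trans _ h1)// leq_addl.
Qed.

Lemma Vcoef_range K m : (m < dd l K)%N -> (0 < Vcoef K m <= K)%N.
Proof.
elim: K => [|K IH] mK; first by rewrite dd0 in mK.
rewrite /=; case: ifP => [/IH/andP[-> /leqW ->]//|_].
by case: ifP => _; rewrite ?leqnn.
Qed.

Variables (K : nat) (K0 : (0 < K)%N) (c : 'rV[R]_(l K)).

(* The vector c placed at the biases of the last layer. *)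
Definition last_bias (m : nat) : R :=
  if (m < l K * l K.-1 + dd l K.-1)%N then 0
  else Defs.coord R (l K) c (m - (l K * l K.-1 + dd l K.-1)).

Lemma coord_ord n (u : 'rV[R]_n) (i : 'I_n) : Defs.coord R n u i = u ord0 i.
Proof. by rewrite /Defs.coord valK. Qed.

Lemma last_biasE i : (i < l K)%N ->
  last_bias (l K * l K.-1 + i + dd l K.-1) = Defs.coord R (l K) c i.
Proof.
move=> iK; have /andP[h1 _] := bias_index K i K0 iK.
by rewrite /last_bias ltnNge h1/= addnAC addKn.
Qed.

Lemma last_bias_weight k i j : (0 < k <= K)%N -> (i < l k)%N -> (j < l k.-1)%N ->
  last_bias (i * l k.-1 + j + dd l k.-1) = 0.
Proof.
move=> /andP[k0 kK] ik jk; have /andP[_ h] := weight_index k i j k0 ik jk.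
rewrite /last_bias ifT//; move: kK; rewrite leq_eqVlt => /predU1P[<-//|kK].
rewrite (leq_trans h)// (leq_trans (first_bias_index k k0))//.
by rewrite (leq_trans (leq_dd k K.-1 _)) ?leq_addl// -ltnS prednK.
Qed.

Lemma last_bias_bias k i : (0 < k < K)%N -> (i < l k)%N ->
  last_bias (l k * l k.-1 + i + dd l k.-1) = 0.
Proof.
move=> /andP[k0 kK] ik; have /andP[_ h] := bias_index k i k0 ik.
rewrite /last_bias ifT// (leq_trans h)//.
by rewrite (leq_trans (leq_dd k K.-1 _)) ?leq_addl// -ltnS prednK.
Qed.

Lemma sum_last_bias (F : nat -> R) : \sum_(m < dd l K) last_bias m * F m =
  \sum_(i < l K) c ord0 i * F (l K * l K.-1 + i + dd l K.-1)%N.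
Proof.
rewrite (sum_layers K (fun m => last_bias m * F m)) big_nat_recr//= big_nat_cond.
rewrite big1 ?add0r => [|k /andP[/andP[k0 kK] _]]; last first.
  rewrite !big1 ?addr0// => i _.
    by rewrite big1// => j _; rewrite last_bias_weight ?mul0r// k0 ltnW.
  by rewrite last_bias_bias ?mul0r ?k0.
rewrite [X in _ + X]big1 ?addr0 => [|i _]; last first.
  by rewrite big1// => j _; rewrite last_bias_weight ?mul0r// K0 leqnn.
by apply: eq_bigr => i _; rewrite last_biasE// coord_ord.
Qed.

(** Where V has a linear term, its quadratic coefficient is exactly [K]. This lets [Vfun_ge]
    complete the square at the cost of a factor [L]; coefficients known only to be at least 1 would
    cost [L^2]. *)
Lemma last_bias_Vcoef m : (m < dd l K)%N ->
  last_bias m = 0 \/ Vcoef K m = K.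
Proof.
rewrite /last_bias; case: ifP => [|/negbT]; first by left.
rewrite -leqNgt => h mK; right.
rewrite (VcoefE _ K) ?K0 ?leqnn// ?ltnNge ?h//.
by rewrite -ltnNge mK andbT (leq_trans _ h)// leq_addl.
Qed.

End layer_indexing.

(** * Quadratic bounds on V, and Euler's identity along its gradient *)

Section lyapunov.
Context (R : realType) (l : nat -> nat) (L : nat) (L0 : (0 < L)%N)
  (c : 'rV[R]_(l L)).
Local Notation d := (dd l L).
Local Notation V := 'rV[R]_d.
Local Notation e := (last_bias l R L c).
Local Notation coef m := ((Vcoef l L m)%:R : R).

Definition Vgrad (th : V) : V :=
  \row_m (2 * coef m * th ord0 m - 2 * L%:R * e m).

Lemma VfunE (th : V) : Vfun R l L d c th =
  \sum_(m < d) (coef m * th ord0 m ^+ 2 - 2 * L%:R * (e m * th ord0 m)).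
Proof.
rewrite sumrB -mulr_sumr; congr (_ - _ * _).
  under [RHS]eq_bigr do rewrite -coord_ord.
  rewrite (sum_layers l R L (fun m => coef m * Defs.coord R d th m ^+ 2)).
  apply: eq_big_nat => k kL; congr (_ + _).
    by rewrite mulr_sumr; apply: eq_bigr => i _; rewrite Vcoef_bias.
  by apply: eq_bigr => i _; apply: eq_bigr => j _; rewrite Vcoef_weight ?mul1r.
under [RHS]eq_bigr do rewrite -coord_ord.
by rewrite (sum_last_bias l R L L0 c (Defs.coord R d th)).
Qed.

Lemma sum_last_bias_sqr : \sum_(m < d) e m ^+ 2 = \sum_(i < l L) c ord0 i ^+ 2.
Proof.
under eq_bigr do rewrite expr2.
rewrite (sum_last_bias l R L L0 c e); apply: eq_bigr => i _.
by rewrite last_biasE// coord_ord expr2.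
Qed.

Lemma coef_range (m : 'I_d) : 1 <= coef m <= L%:R.
Proof. by rewrite ler1n ler_nat; exact: Vcoef_range. Qed.

(** Coordinatewise, the right side exceeds the left by [2 (coef m - 1) th_m^2 + (th_m - 2 L
    e_m)^2]. *)
Lemma Vfun_coercive (th : V) :
  \sum_(m < d) th ord0 m ^+ 2 <=
  2 * Vfun R l L d c th + 4 * L%:R ^+ 2 * \sum_(i < l L) c ord0 i ^+ 2.
Proof.
rewrite VfunE -sum_last_bias_sqr !mulr_sumr -big_split; apply: ler_sum => m _ /=.
have /andP[k1 _] := coef_range m.
have h : 0 <= (coef m - 1) * th ord0 m ^+ 2 by rewrite mulr_ge0 ?sqr_ge0 ?subr_ge0.
have := sqr_ge0 (th ord0 m - 2 * L%:R * e m); nra.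
Qed.

Lemma Vfun_ge (th : V) : - (L%:R * \sum_(i < l L) c ord0 i ^+ 2) <= Vfun R l L d c th.
Proof.
rewrite VfunE -sum_last_bias_sqr mulr_sumr -sumrN; apply: ler_sum => m _ /=.
have /andP[k1 _] := coef_range m.
have [->|->] := last_bias_Vcoef l R L L0 c m (ltn_ord m).
  have : 0 <= coef m * th ord0 m ^+ 2 by rewrite mulr_ge0// sqr_ge0.
  by rewrite expr0n/= mul0r !mulr0; lra.
have : 0 <= L%:R * (th ord0 m - e m) ^+ 2 by rewrite mulr_ge0// sqr_ge0.
nra.
Qed.

(** Coordinatewise, the right side exceeds the left by [(L - coef m) th_m^2 + L (th_m + e_m)^2]. *)
Lemma Vfun_le (th : V) : Vfun R l L d c th <=
  2 * L%:R * \sum_(m < d) th ord0 m ^+ 2 + L%:R * \sum_(i < l L) c ord0 i ^+ 2.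
Proof.
rewrite VfunE -sum_last_bias_sqr !mulr_sumr -big_split; apply: ler_sum => m _ /=.
have /andP[_ kL] := coef_range m.
have : 0 <= L%:R * (th ord0 m + e m) ^+ 2 by rewrite mulr_ge0// sqr_ge0.
have : 0 <= (L%:R - coef m) * th ord0 m ^+ 2 by rewrite mulr_ge0 ?sqr_ge0 ?subr_ge0.
nra.
Qed.

Lemma Vfun_has_gradient : has_gradient R d (Vfun R l L d c) Vgrad.
Proof.
move=> th v h.
rewrite (_ : (fun _ => _) = fun k => \sum_(m < d)
    ((coef m * (th ord0 m + k * v ord0 m)) * (th ord0 m + k * v ord0 m) -
     2 * L%:R * e m * (th ord0 m + k * v ord0 m))); last first.
  by apply/funext => k; rewrite VfunE; apply: eq_bigr => m _; rewrite !mxE; ring.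
rewrite -fct_sumE; apply: is_derive_sum => m.
have h1 := is_derive_affine R (th ord0 m) (v ord0 m) h.
have h2 := is_deriveZ (coef m) h1.
have h3 := is_deriveZ (2 * L%:R * e m) h1.
apply: is_derive_eq (is_deriveB (is_deriveM h2 h1) h3) _.
rewrite !mxE [LHS](_ : _ = coef m * (th ord0 m + h * v ord0 m) * v ord0 m +
  (th ord0 m + h * v ord0 m) * (coef m * v ord0 m) - 2 * L%:R * e m * v ord0 m)//.
ring.
Qed.

Lemma continuous_Vgrad : continuous Vgrad.
Proof.
move=> th; apply: (@cvg_rV R V (nbhs th) _ d Vgrad (Vgrad th)) => m.
rewrite mxE; under eq_fun do rewrite mxE.
apply: cvgB; last exact: cvg_cst.
by apply: cvgM; [exact: cvg_cst|exact: coord_continuous].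
Qed.

Lemma coord_Vgrad (th : V) m : (m < d)%N -> Defs.coord R d (Vgrad th) m =
  2 * coef m * Defs.coord R d th m - 2 * L%:R * e m.
Proof.
by move=> md; rewrite (coord_ord R d _ (Ordinal md)) (coord_ord R d _ (Ordinal md)) mxE.
Qed.

(** With the shift [2 L c], Euler's identity makes the derivative of the output along [Vgrad] equal
    to [2 L] times the residual; the other factor in the derivative of the squared error is twice
    the residual. *)
Lemma dsqerr_Vgrad (th : V) x :
  dsqerr R l d L c (sig_inf R) (dsig_inf R) th (Vgrad th) x =
  4 * L%:R * sqerr R l d L c (sig_inf R) th x.
Proof.
rewrite /dsqerr /sqerr mulr_sumr; apply: eq_bigr => i _.
rewrite (dnet_homogeneous R l d _ _ _ _ _
  (fun i => 2 * L%:R * Defs.coord R (l L) c i) L)//.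
- by rewrite eqxx coord_ord; ring.
- move=> k y; rewrite /dsig_inf /sig_inf.
  by case: ltP => _; rewrite ?mul1r ?mul0r.
- move=> k i' j kL ik jk; have k0 : (0 < k)%N by case/andP: kL.
  have /andP[_ h] := weight_index l k i' j k0 ik jk.
  rewrite /wgt coord_Vgrad ?Vcoef_weight// ?last_bias_weight// ?mulr0 ?subr0 ?mulr1//.
  rewrite (leq_trans h)// (leq_trans (first_bias_index l k k0))// leq_dd//.
  by case/andP: kL.
- move=> k i' kL ik; have k0 : (0 < k)%N by case/andP: kL.
  have /andP[_ h] := bias_index l k i' k0 ik.
  rewrite /bia coord_Vgrad ?Vcoef_bias//; last first.
    by rewrite (leq_trans h)// leq_dd//; case/andP: kL.
  congr (_ - _); have [kE|kL'] := eqVneq k L.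
    by subst k; rewrite last_biasE.
  by rewrite last_bias_bias ?mulr0// k0 ltn_neqAle kL'; case/andP: kL.
- by rewrite L0 leqnn.
Qed.

End lyapunov.

Lemma enorm_sqr (R : realType) n (v : 'rV[R]_n) :
  enorm v ^+ 2 = \sum_(i < n) v ord0 i ^+ 2.
Proof. by rewrite sqr_sqrtr// sumr_ge0// => i _; exact: sqr_ge0. Qed.

Lemma has_gradient_derive (R : realType) d (F : 'rV[R]_d -> R) DF th v :
  has_gradient R d F DF -> 'D_v F th = edot (DF th) v.
Proof.
move=> /(_ th v 0) FD.
have -> : edot (DF th) v = 'D_1 (fun k : R => F (th + k *: v)) 0.
  by rewrite (@derive_val _ _ _ _ _ _ _ FD) scale0r addr0.
rewrite /derive (_ : (fun h => h^-1 *: ((F \o shift th) (h *: v) - F th)) =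
  fun h : R => h^-1 *: (((fun k : R => F (th + k *: v)) \o shift 0) (h *: 1) -
    F (th + 0 *: v)))//.
by apply/funext => h /=; rewrite addr0 scale0r addr0 [_ *: 1]mulr1 (addrC th).
Qed.

Lemma grad_of_gradient (R : realType) d (F : 'rV[R]_d -> R) DF th :
  has_gradient R d F DF -> grad R d F th = DF th.
Proof.
move=> FD; apply/rowP => m; rewrite mxE (has_gradient_derive _ _ _ _ _ _ FD).
rewrite /edot (bigD1 m)//= mxE !eqxx mulr1 big1 ?addr0// => i im.
by rewrite mxE (negbTE im) andbF mulr0.
Qed.

Lemma limf_esup_pinfty_eq0 (R : realType) (f : R -> R) (K : R) :
  (forall t, 0 <= f t) -> (forall t, 0 < t -> f t <= K / t) ->
  limf_esup (fun t => (f t)%:E) (+oo%R : set_system R) = 0%E.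
Proof.
move=> f0 fK; apply/eqP; rewrite eq_le; apply/andP; split; last first.
  apply: limf_esup_ge0 => [[M [_ /(_ (M + 1))]]|t]; last by rewrite lee_fin.
  by apply; rewrite ltrDl.
apply/lee_addgt0Pr => eps eps0; rewrite add0e.
(* Past [|K| / eps] the bound [K / t] is at most [eps]; the absolute value spares a sign condition
   on [K]. *)
apply: (@le_trans _ _ (ereal_sup ((fun t => (f t)%:E) @` [set t | `|K| / eps < t]))).
  apply: ereal_inf_lbound; exists [set t | `|K| / eps < t] => //.
  by exists (`|K| / eps); split => //; exact: num_real.
apply: ge_ereal_sup => _ [t /= Kt <-]; rewrite lee_fin.
have t0 : 0 < t by rewrite (le_lt_trans _ Kt)// divr_ge0// ltW.
rewrite (le_trans (fK t t0))// ler_pdivrMr// (le_trans (ler_norm K))//.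
by rewrite mulrC -ler_pdivrMr// ltW.
Qed.

(** * The gradient flow *)

Section gradient_flow.
Context (R : realType) (l : nat -> nat) (L : nat) (a b A B C : R)
  (Rr : R -> R -> R).
Local Notation d := (dd l L).
Local Notation V := 'rV[R]_d.
Local Notation D := (cube R (l 0%N) a b : set (borelRn R (l 0%N))).
Variables (mu : {measure set (borelRn R (l 0%N)) -> \bar R}) (c : 'rV[R]_(l L)).
Hypotheses (L0 : (0 < L)%N) (A0 : 0 < A) (AB : A < B).
Hypothesis RrP : forall r, 1 <= r ->
  (forall x, derivable (Rr r) x 1) /\ continuous (derive1 (Rr r)) /\
  (forall x, x <= A / r -> Rr r x = 0) /\
  (forall y, 0 <= Rr r y <= Num.max y 0) /\
  (forall z, B / r <= z -> Rr r z = z).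
Hypothesis RrC : forall r, 1 <= r -> forall x, `|(derive1 (Rr r)) x| <= C.
Hypothesis muD : (mu D < +oo)%E.

Local Notation risk_fin r := (risk R l d L a b mu c (sig_fin R Rr r)).
Local Notation risk_inf := (risk R l d L a b mu c (sig_inf R)).
Local Notation grad_fin r :=
  (risk_grad R l d L a b mu c (sig_fin R Rr r) (dsig_fin R Rr r)).
Local Notation grad_inf := (risk_grad R l d L a b mu c (sig_inf R) (dsig_inf R)).
Local Notation leb := (@lebesgue_measure R).

Let sub_fin r (r1 : 1 <= r) := subidentity_fin R A B Rr RrP r r1.
Let bd_fin r (r1 : 1 <= r) := bounded_dsig_fin R C Rr RrC r r1.
Let ms_fin r k (r1 : 1 <= r) := measurable_sig_fin R A B Rr RrP r k r1.
Let mds_fin r k (r1 : 1 <= r) := measurable_dsig_fin R A B Rr RrP r k r1.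

Lemma risk_fin_has_gradient r : 1 <= r -> has_gradient R d (risk_fin r) (grad_fin r).
Proof.
move=> r1; apply: (risk_has_gradient R l d L a b mu c muD (Num.max C 1)).
- exact: sub_fin.
- exact: bd_fin.
- by move=> k; exact: ms_fin.
- by move=> k; exact: mds_fin.
- by move=> k y _; exact: (is_derive_sig_fin R A B Rr RrP r k y r1).
Qed.

Lemma continuous_grad_fin r : 1 <= r -> continuous (grad_fin r).
Proof.
move=> r1 th.
have cn x k i : net R l d u (sig_fin R Rr r) x k i @[u --> th] -->
    net R l d th (sig_fin R Rr r) x k i.
  apply: (@cvg_net R l d V (nbhs th) _ id th (fun=> sig_fin R Rr r)).
    move=> m; rewrite /Defs.coord; case: insub => [j|]; last exact: cvg_cst.
    exact: coord_continuous.
  move=> k' yu y _ yuy.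
  exact: (cvg_comp _ _ yuy (continuous_sig_fin R A B Rr RrP r k' r1 y)).
have [] := @cvg_risk_grad R l d L a b mu c muD V (nbhs th) _ _ id th
  (fun=> sig_fin R Rr r) (fun=> dsig_fin R Rr r) (sig_fin R Rr r) (dsig_fin R Rr r)
  (`|th| + 1) (Num.max C 1) (countably_based_nbhs R V th); last by [].
- move=> m; rewrite /Defs.coord; case: insub => [j|]; last exact: cvg_cst.
  exact: coord_continuous.
- by apply: nearW => u; split=> [||k|k];
    [exact: sub_fin|exact: bd_fin|exact: ms_fin|exact: mds_fin].
- apply: filterS (nbhsx_ballx th 1 ltr01) => u; rewrite -ball_normE /= => uth.
  rewrite -[u in leLHS](subKr th) (le_trans (ler_normB _ _))// lerD2l.
  exact: ltW.
- by move=> x k i _; exact: cn.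
- move=> x k i _.
  exact: (cvg_comp _ _ (cn x k i) (continuous_sig_fin R A B Rr RrP r k r1 _)).
- move=> x k i _.
  exact: (cvg_comp _ _ (cn x k i) (continuous_dsig_fin R A B Rr RrP r k r1 _)).
- exact: L0.
Qed.

Lemma cvg_risk_fin th : risk_fin r th @[r --> +oo] --> risk_inf th /\
  grad_fin r th @[r --> +oo] --> grad_inf th.
Proof.
apply: (@cvg_risk_grad R l d L a b mu c muD R +oo%R _ _ (fun=> th) th
  (fun r => sig_fin R Rr r) (fun r => dsig_fin R Rr r) (sig_inf R) (dsig_inf R)
  `|th| (Num.max C 1) (countably_based_pinfty R)) => //.
- by move=> m; exact: cvg_cst.
- near=> r; have r1 : 1 <= r by near: r; exact: nbhs_pinfty_ge.
  by split=> [||k|k]; [exact: sub_fin|exact: bd_fin|exact: ms_fin|exact: mds_fin].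
- exact: nearW.
- by move=> x k i k0; exact: (cvg_net_fin R A B Rr A0 AB RrP).
- by move=> x k i k0; exact: (cvg_sig_net_fin R A B Rr A0 AB RrP).
- by move=> x k i k0; exact: (cvg_dsig_net_fin R A B Rr A0 AB RrP).
Unshelve. all: by end_near. Qed.

Variables (G : V -> V) (Theta : R -> V).
Hypothesis GE : forall th, G th = grad_inf th.
Hypothesis cTheta : {within `[0, +oo[, continuous Theta}.
Hypothesis ThetaG : forall t : R, 0 <= t -> forall i : 'I_d,
  leb.-integrable `[0, t] (fun s => (G (Theta s) ord0 i)%:E) /\
  Theta t ord0 i = Theta 0 ord0 i - \int[leb]_(s in `[0, t]) G (Theta s) ord0 i.

Let cThetaT (T : R) : {within `[0, T], continuous Theta}.
Proof.
apply: continuous_subspaceW cTheta.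
by apply: subset_itv; rewrite bnd_simp.
Qed.

(** [G] may be discontinuous, so measurability along the curve is taken from the integrability in
    the integral equation. *)
Let mG (T : R) i : 0 <= T -> measurable_fun `[0, T] (fun s => G (Theta s) ord0 i).
Proof.
move=> T0; have [/integrableP[h _] _] := ThetaG T T0 i.
exact/measurable_EFinP.
Qed.

Let Theta_bounded (T : R) : 0 <= T ->
  exists M : R, forall s : R, 0 <= s <= T -> `|Theta s| <= M.
Proof.
(* With [id] as the vector field, the bound along the curve is a bound on the curve itself. *)
move=> T0; have := @gradient_curve_bounded R d id Theta T.
by apply => //; move=> th; exact: cvg_id.
Qed.

(** The bound is the same for all [r >= 1], as [C] bounds all smoothed derivatives; [M * M *+ d]
    then dominates the integrands in [flow_risk]. *)
Let grad_bounded (T : R) : 0 <= T -> exists M : R,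
  (forall (s : R) i, 0 <= s <= T -> `|G (Theta s) ord0 i| <= M) /\
  (forall (s r : R) i, 1 <= r -> 0 <= s <= T -> `|grad_fin r (Theta s) ord0 i| <= M).
Proof.
move=> T0; have [M MP] := Theta_bounded T T0.
have [M' M'0 M'P] := risk_grad_bound R l d L a b mu c muD M (Num.max C 1).
exists M'; split => [s i sT|s r i r1 sT].
  rewrite GE; apply: M'P; last exact: MP.
  - exact: subidentity_inf.
  - exact: bounded_dsig_inf.
  - exact: measurable_sig_inf.
  - exact: measurable_dsig_inf.
apply: M'P; last exact: MP.
- exact: sub_fin.
- exact: bd_fin.
- by move=> k; exact: ms_fin.
- by move=> k; exact: mds_fin.
Qed.

Lemma flow_risk (t : R) : 0 <= t -> risk_inf (Theta t) =
  risk_inf (Theta 0) - \int[leb]_(s in `[0, t]) edot (G (Theta s)) (G (Theta s)).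
Proof.
move=> t0; have [M [GM gM]] := grad_bounded t t0.
have Th (u : R) i : 0 <= u <= t -> Theta u ord0 i =
    Theta 0 ord0 i - \int[leb]_(s in `[0, u]) G (Theta s) ord0 i.
  by move=> /andP[u0 _]; have [] := ThetaG u u0 i.
have chain r : 1 <= r -> risk_fin r (Theta t) = risk_fin r (Theta 0) -
    \int[leb]_(s in `[0, t]) edot (grad_fin r (Theta s)) (G (Theta s)).
  move=> r1; apply: (@gradient_chain_rule R d _ _ Theta (G \o Theta) t M) => //.
  - exact: risk_fin_has_gradient.
  - exact: continuous_grad_fin.
  - by move=> i; exact: mG.
have lim1 : risk_fin r (Theta t) @[r --> +oo] --> risk_inf (Theta t).
  by have [] := cvg_risk_fin (Theta t).
(* Only one factor of the inner product depends on [r]; the other is the velocity of the curve,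
   already the limit gradient, so a squared norm appears. *)
have lim2 : risk_fin r (Theta 0) - \int[leb]_(s in `[0, t])
    edot (grad_fin r (Theta s)) (G (Theta s)) @[r --> +oo] -->
    risk_inf (Theta 0) - \int[leb]_(s in `[0, t]) edot (G (Theta s)) (G (Theta s)).
  apply: cvgB; first by have [] := cvg_risk_fin (Theta 0).
  apply: (Rintegral_cvg _ _ _ leb `[0, t]%classic (measurable_itv _)
    (lebesgue_itv_fin R 0 t) _ _ _ (M * M *+ d) (countably_based_pinfty R)).
  - near=> r; have r1 : 1 <= r by near: r; exact: nbhs_pinfty_ge.
    apply: (@measurable_edot_curve R d (G \o Theta)) => [i|i]; first exact: mG.
    by apply: measurable_gradient_curve => //; exact: continuous_grad_fin.
  - near=> r; have r1 : 1 <= r by near: r; exact: nbhs_pinfty_ge.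
    move=> s; rewrite /= in_itv/= => st.
    by apply: edot_bound => i; [exact: gM|exact: GM].
  - move=> s _; apply: cvg_sum_ord => i; apply: cvgM; last exact: cvg_cst.
    have [_ h] := cvg_risk_fin (Theta s); rewrite GE.
    exact: (cvg_comp _ _ h (@coord_continuous R 1 d ord0 i _)).
have lim3 : risk_fin r (Theta t) @[r --> +oo] -->
    risk_inf (Theta 0) - \int[leb]_(s in `[0, t]) edot (G (Theta s)) (G (Theta s)).
  apply: cvg_trans lim2; apply: near_eq_cvg; near=> r.
  by rewrite chain//; near: r; exact: nbhs_pinfty_ge.
exact: (cvg_unique _ lim1 lim3).
Unshelve. all: by end_near. Qed.

Lemma edot_ge0 (v : V) : 0 <= edot v v.
Proof. by apply: sumr_ge0 => i _; rewrite -expr2 sqr_ge0. Qed.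

Lemma flow_risk_nonincreasing (s t : R) : 0 <= s <= t ->
  risk_inf (Theta t) <= risk_inf (Theta s).
Proof.
move=> /andP[s0 st]; have t0 := le_trans s0 st.
rewrite (flow_risk t t0) (flow_risk s s0) lerD2l lerN2 -subr_ge0.
have [M [GM _]] := grad_bounded t t0.
rewrite -Rintegral_itv0B ?s0//.
  by apply: Rintegral_ge0 => u _; exact: edot_ge0.
apply: (@bounded_Rintegrable _ _ _ leb _ _ _ _ (M * M *+ d)) => //.
- exact: lebesgue_itv_fin.
- by apply: (@measurable_edot_curve R d (G \o Theta)) => i; exact: mG.
- move=> u; rewrite /= in_itv/= => ut.
  by apply: edot_bound => i; exact: GM.
Qed.

Lemma flow_lyapunov (t : R) : 0 <= t ->
  4 * L%:R * t * risk_inf (Theta t) <=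
  Vfun R l L d c (Theta 0) - Vfun R l L d c (Theta t).
Proof.
move=> t0; have [M [GM _]] := grad_bounded t t0.
have Th (u : R) i : 0 <= u <= t -> Theta u ord0 i =
    Theta 0 ord0 i - \int[leb]_(s in `[0, u]) G (Theta s) ord0 i.
  by move=> /andP[u0 _]; have [] := ThetaG u u0 i.
have mGt i : measurable_fun `[0, t] (fun s => (G \o Theta) s ord0 i) by exact: mG.
have E s : edot (Vgrad R l L c (Theta s)) (G (Theta s)) =
    4 * L%:R * risk_inf (Theta s).
  rewrite GE (_ : edot _ _ = edot (grad_inf (Theta s)) (Vgrad R l L c (Theta s))).
    rewrite (edot_risk_grad R l d L a b mu c muD (Num.max C 1)).
    - under eq_Rintegral do rewrite dsqerr_Vgrad//.
      rewrite RintegralZl//; first exact: measurable_cube.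
      apply: (integrable_sqerr R l d L a b mu c muD (Num.max C 1) _ (dsig_inf R)).
      + exact: subidentity_inf.
      + exact: bounded_dsig_inf.
      + exact: measurable_sig_inf.
    - exact: subidentity_inf.
    - exact: bounded_dsig_inf.
    - exact: measurable_sig_inf.
    - exact: measurable_dsig_inf.
  by apply: eq_bigr => i _; rewrite mulrC.
have := @gradient_chain_rule R d _ _ Theta (G \o Theta) t M t0
  (Vfun_has_gradient R l L L0 c) (continuous_Vgrad R l L c) (cThetaT t) mGt
  (fun s i => GM s i) Th.
move=> ->; rewrite opprB addrC subrK.
have mut : fine (leb `[0, t]%classic) = t.
  rewrite lebesgue_measure_itv/= lte_fin; case: ltP => /= [_|ts]; first by rewrite subr0.
  by apply: le_anti; rewrite ts t0.
have -> : 4 * L%:R * t * risk_inf (Theta t) =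
    \int[leb]_(s in `[0, t]) (4 * L%:R * risk_inf (Theta t)).
  by rewrite Rintegral_cst ?[fine _]mut; [exact: mulrAC|exact: measurable_itv].
apply: le_Rintegral; first exact: measurable_itv.
- apply: (@bounded_Rintegrable _ _ _ leb _ (measurable_itv _)
    (lebesgue_itv_fin R 0 t) (cst _) `|4 * L%:R * risk_inf (Theta t)|) => //.
- apply: (@integrable_gradient_curve R d (Vgrad R l L c) Theta (G \o Theta) t M) => //.
  exact: continuous_Vgrad.
- move=> s; rewrite /= in_itv/= [edot _ _]E => st.
  by rewrite ler_wpM2l ?mulr_ge0// flow_risk_nonincreasing.
Qed.

End gradient_flow.

Theorem theorem3p8 (R : realType) (L d : nat) (l : nat -> nat)
  (a b A B : R) (Rr : R -> R -> R)
  (mu : {measure set (borelRn R (l 0%N)) -> \bar R})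
  (f : 'rV[R]_(l 0%N) -> 'rV[R]_(l L))
  (G : 'rV[R]_d -> 'rV[R]_d) (Theta : R -> 'rV[R]_d) :
  (0 < L)%N -> (forall k, (0 < l k)%N) ->
  d = dd l L ->
  a < b -> 0 < A -> A < B ->
  (* the smoothed activations R_r, r in [1, oo) *)
  (forall r, 1 <= r ->
     (forall x, derivable (Rr r) x 1) /\ continuous (derive1 (Rr r)) /\
     (forall x, x <= A / r -> Rr r x = 0) /\
     (forall y, 0 <= Rr r y <= Num.max y 0) /\
     (forall z, B / r <= z -> Rr r z = z)) ->
  (exists C : R, forall r, 1 <= r -> forall x, `|(derive1 (Rr r)) x| <= C) ->
  (* mu is a finite measure on [a,b]^{l_0} *)
  (mu (cube R (l 0%N) a b) < +oo)%E ->
  (* f is measurable *)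
  (forall i, measurable_fun setT (fun x : borelRn R (l 0%N) => f x ord0 i)) ->
  (* the integrals defining L_r, r in [1,oo], are real numbers *)
  (forall (th : 'rV[R]_d) r, 1 <= r ->
     (\int[mu]_(x in cube R (l 0%N) a b)
        (\sum_(i < l L) (net R l d th (sig_fin R Rr r) x L i - f x ord0 i) ^+ 2)%:E
      < +oo)%E) ->
  (forall th : 'rV[R]_d,
     (\int[mu]_(x in cube R (l 0%N) a b)
        (\sum_(i < l L) (net R l d th (sig_inf R) x L i - f x ord0 i) ^+ 2)%:E
      < +oo)%E) ->
  (* G is the pointwise limit of the gradients wherever it exists *)
  (forall (th lim : 'rV[R]_d),
     grad R d (loss R l L d a b mu f (sig_fin R Rr r)) th @[r --> +oo] --> lim ->
     G th = lim) ->
  (* f is constant on [a,b]^{l_0} *)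
  (forall x, cube R (l 0%N) a b x -> f x = f 0) ->
  (* Theta is a continuous solution of the gradient flow integral equation *)
  {within `[0, +oo[, continuous Theta} ->
  (forall t, 0 <= t -> forall i : 'I_d,
     lebesgue_measure.-integrable `[0, t] (fun s => (G (Theta s) ord0 i)%:E) /\
     Theta t ord0 i = Theta 0 ord0 i
       - fine (\int[lebesgue_measure]_(s in `[0, t]) (G (Theta s) ord0 i)%:E)) ->
  (forall t, 0 <= t ->
     enorm (Theta t) <=
       Num.sqrt (2 * Vfun R l L d (f 0) (Theta 0)
                 + 4 * L%:R ^+ 2 * enorm (f 0) ^+ 2))
  /\ (forall t, 0 < t ->
     loss R l L d a b mu f (sig_inf R) (Theta t) <=
       (enorm (Theta 0) ^+ 2 + 2 * L%:R * enorm (f 0) ^+ 2) / (2 * t))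
  /\ limf_esup (fun t => (loss R l L d a b mu f (sig_inf R) (Theta t))%:E)
       (+oo%R : set_system R) = 0%E.
Proof.
move=> L0 _ dE _ A0 AB RrP [C RrC] muD _ _ _ GP fc cTheta ThetaG; subst d.
(* Only the values of [f] on the cube enter the integral, so the constant [f 0] can stand for [f]
   even when the origin lies outside the cube. *)
have lossE sig : loss R l L (dd l L) a b mu f sig =
    risk R l (dd l L) L a b mu (f 0) sig.
  apply/funext => th; apply: (@eq_Rintegral _ _ _ mu (cube R (l 0%N) a b)) => x.
  by move=> /set_mem Dx; apply: eq_bigr => i _; rewrite fc.
have GE th : G th = risk_grad R l (dd l L) L a b mu (f 0) (sig_inf R) (dsig_inf R) th.
  apply: GP.
  have [_ h] := cvg_risk_fin R l L a b A B C Rr mu (f 0) L0 A0 AB RrP RrC muD th.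
  apply: cvg_trans h; apply: near_eq_cvg; near=> r.
  have r1 : 1 <= r by near: r; exact: nbhs_pinfty_ge.
  rewrite lossE; symmetry; apply: grad_of_gradient.
  exact: (risk_fin_has_gradient R l L a b A B C Rr mu (f 0) RrP RrC muD).
have lyap := flow_lyapunov R l L a b A B C Rr mu (f 0) L0 A0 AB RrP RrC muD
  G Theta GE cTheta ThetaG.
have risk_ge0 th : 0 <= risk R l (dd l L) L a b mu (f 0) (sig_inf R) th.
  apply: Rintegral_ge0 => x _; apply: sumr_ge0 => i _; exact: sqr_ge0.
rewrite lossE.
have L1 : 1 <= L%:R :> R by rewrite ler1n.
have c0 : 0 <= enorm (f 0) ^+ 2 by exact: sqr_ge0.
have decay (t : R) : 0 < t -> risk R l (dd l L) L a b mu (f 0) (sig_inf R) (Theta t) <=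
    (enorm (Theta 0) ^+ 2 + 2 * L%:R * enorm (f 0) ^+ 2) / (2 * t).
  move=> t0; have := lyap t (ltW t0).
  have := Vfun_ge R l L L0 (f 0) (Theta t).
  have := Vfun_le R l L L0 (f 0) (Theta 0).
  rewrite -!enorm_sqr ler_pdivlMr ?mulr_gt0// => V0 Vt V0t.
  (* The Lyapunov estimate and the two bounds on V give [4 L t risk <= 2 L |Theta_0|^2 + 2 L |f
     0|^2]. The goal is scaled by [2 L] to match, and [L >= 1] bounds the last term by
     [4 L^2 |f 0|^2]. *)
  rewrite -(@ler_pM2l _ (2 * L%:R)) ?mulr_gt0// ?(lt_le_trans ltr01 L1)//.
  have : 0 <= (L%:R - 1) * (L%:R * enorm (f 0) ^+ 2).
    by rewrite mulr_ge0 ?subr_ge0// mulr_ge0.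
  by move: V0 Vt V0t; set x := risk _ _ _ _ _ _ _ _ _ _; nra.
split=> [t t0|]; [|split=> //].
  rewrite {1}/enorm ler_wsqrtr// enorm_sqr.
  (* As the risk is nonnegative, V at [Theta t] is at most V at [Theta 0], which is inserted into
     the coercivity bound. *)
  have := Vfun_coercive R l L L0 (f 0) (Theta t); have := lyap t t0.
  have : 0 <= 4 * L%:R * t * risk R l (dd l L) L a b mu (f 0) (sig_inf R) (Theta t).
    by rewrite !mulr_ge0.
  lra.
apply: (limf_esup_pinfty_eq0 _ _
  ((enorm (Theta 0) ^+ 2 + 2 * L%:R * enorm (f 0) ^+ 2) / 2)) => // t t0.
by rewrite -mulrA -invfM decay.
Unshelve. all: by end_near. Qed.
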